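(* For every $n\ge1$ and every partition $\lambda\vdash n$, $\langle (2n)!\,A_n,s_\lambda\rangle=f^{\rho(\lambda)}$, the number of standard Young tableaux of the skew shape $\rho(\lambda)$.
   Context: $A_n=\frac{1}{(2n)!}\sum_{\lambda\vdash n}|\phi(\lambda)|\,p_\lambda$, where for $\lambda=\langle 1^{m_1},\dots,n^{m_n}\rangle\vdash n$ ($m_k$ parts equal to $k$), $\phi(\lambda)=(2n)!\prod_{k=1}^n\frac{1}{m_k!}\left(\frac{4^k(4^k-1)B_{2k}}{(2k)(2k)!}\right)^{m_k}$ with $B_{2k}$ Bernoulli numbers, and $p_\lambda$ power sums; $\langle\cdot,\cdot\rangle$ is the Hall inner product and $s_\lambda$ the Schur function. For $\lambda\vdash n$ let $\lambda'$ be the conjugate partition and $\ell=\ell(\lambda')$ its number of parts. Then $\rho(\lambda)=\sigma/\tau$ is the skew shape with $\sigma_i=2\lambda'_i+\ell-i$ and $\tau_i=\ell-i$ for $1\le i\le\ell$; equivalently, row $i$ of $\rho(\lambda)$ has length $2\lambda'_i$ and each row begins one square to the left of the row above. (E.g. $\rho(5,3,1,1)=(12,7,6,3,2)/(4,3,2,1)$.) *)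

(* Defs.v *)
From HB Require Import structures.
From mathcomp Require Import all_boot all_order all_algebra.
From mathcomp.multinomials Require Import mpoly.
From Stdlib Require Import ClassicalEpsilon.

Set Implicit Arguments.
Unset Strict Implicit.
Unset Printing Implicit Defensive.

Import Order.TTheory GRing.Theory Num.Theory.
Local Open Scope ring_scope.

Definition is_part (n : nat) (s : seq nat) : bool :=
  [&& sorted geq s, 0%N \notin s & sumn s == n].

(* The length and the parts of a partition of n are at most n; the bounds only
   serve to make [intpart n] a finite type, see [intpartP]. *)
Record intpart (n : nat) : predArgType := IntPart {
  part_bseq : n.-bseq 'I_n.+1;
  _ : is_part n [seq nat_of_ord k | k <- part_bseq] }.

HB.instance Definition _ (n : nat) := [isSub for @part_bseq n].
HB.instance Definition _ (n : nat) := [Finite of intpart n by <:].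

Definition parts (n : nat) (la : intpart n) : seq nat :=
  [seq nat_of_ord k | k <- part_bseq la].

Lemma partsP (n : nat) (la : intpart n) : is_part n (parts la).
Proof. by case: la. Qed.

Lemma parts_inj (n : nat) : injective (@parts n).
Proof.
by move=> la mu /(inj_map (@ord_inj _)) eq_s; apply/val_inj/val_inj.
Qed.

Lemma intpartP (n : nat) (s : seq nat) :
  is_part n s -> exists la : intpart n, parts la = s.
Proof.
move=> part_s; have /and3P[_ s_pos /eqP sum_s] := part_s.
have le_sum t : 0%N \notin t -> (size t <= sumn t)%N /\
    forall k, k \in t -> (k <= sumn t)%N.
  elim: t => [|k t IHt] //=; rewrite inE negb_or eq_sym -lt0n => /andP[k0 /IHt].
  move=> [le_sz le_t]; split=> [|j]; first by rewrite -add1n leq_add.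
  rewrite inE => /predU1P[-> | /le_t le_j]; first exact: leq_addr.
  exact: leq_trans le_j (leq_addl _ _).
have [] := le_sum _ s_pos; rewrite sum_s => le_sz le_s.
have val_s : [seq nat_of_ord k | k <- [seq (inord k : 'I_n.+1) | k <- s]] = s.
  rewrite -map_comp -[RHS]map_id; apply/eq_in_map => k /le_s le_k /=.
  by rewrite inordK.
have sz_s : (size [seq (inord k : 'I_n.+1) | k <- s] <= n)%N by rewrite size_map.
have part_s' : is_part n [seq nat_of_ord k | k <- Bseq sz_s] by rewrite /= val_s.
by exists (IntPart part_s').
Qed.

Definition conj_part (s : seq nat) : seq nat :=
  mkseq (fun j => count (fun k => j < k)%N s) (head 0%N s).

(* A skew shape sigma/tau is encoded as the pair (sigma, tau); missing parts of
   tau are read as 0. Rows and columns are numbered from 0, so [rho_shape] has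
   i.+1 where the 1-based formulas have i. *)
Definition rho_shape (s : seq nat) : seq nat * seq nat :=
  let c := conj_part s in
  let l := size c in
  (mkseq (fun i => 2 * nth 0 c i + l - i.+1)%N l,
   mkseq (fun i => l - i.+1)%N l).

Example rho_shape_5311 :
  rho_shape [:: 5; 3; 1; 1]%N = ([:: 12; 7; 6; 3; 2], [:: 4; 3; 2; 1; 0])%N.
Proof. by []. Qed.

Record cell (sh : seq nat * seq nat) : predArgType := Cell {
  cell_pos : 'I_(size sh.1) * 'I_(\max_(k <- sh.1) k);
  _ : (nth 0 sh.2 cell_pos.1 <= cell_pos.2 < nth 0 sh.1 cell_pos.1)%N }.

HB.instance Definition _ (sh : seq nat * seq nat) := [isSub for @cell_pos sh].
HB.instance Definition _ (sh : seq nat * seq nat) :=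
  [Finite of cell sh by <:].

Definition crow (sh : seq nat * seq nat) (c : cell sh) : nat := (cell_pos c).1.
Definition ccol (sh : seq nat * seq nat) (c : cell sh) : nat := (cell_pos c).2.

Definition is_ssyt (sh : seq nat * seq nat) (N : nat)
    (T : {ffun cell sh -> 'I_N}) : bool :=
  [forall c, forall d,
     ((crow c == crow d) && (ccol c < ccol d)%N ==> (T c <= T d)%N) &&
     ((ccol c == ccol d) && (crow c < crow d)%N ==> (T c < T d)%N)].

Definition is_syt (sh : seq nat * seq nat)
    (T : {ffun cell sh -> 'I_#|cell sh|}) : bool :=
  injectiveb T &&
  [forall c, forall d,
     ((crow c == crow d) && (ccol c < ccol d)%N ==> (T c < T d)%N) &&
     ((ccol c == ccol d) && (crow c < crow d)%N ==> (T c < T d)%N)].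

Definition num_syt (sh : seq nat * seq nat) : nat :=
  #|[set T : {ffun cell sh -> 'I_#|cell sh|} | is_syt T]|.

(* A symmetric function is given by its restrictions f(x_1, ..., x_N), for all
   N, as in the construction of the ring of symmetric functions as an inverse
   limit of rings of symmetric polynomials. *)
Definition symfun : Type := forall N : nat, {mpoly rat[N]}.

Definition monomial_sf (s : seq nat) : symfun := fun N =>
  \sum_(m : 'X_{1..N < (sumn s).+1} | perm_eq [seq e <- val m | e != 0%N] s)
     'X_[m].

Definition complete_sf (k : nat) : symfun := fun N =>
  \sum_(m : 'X_{1..N < k.+1} | mdeg m == k) 'X_[m].

Definition complete_part_sf (s : seq nat) : symfun := fun N =>
  \prod_(k <- s) complete_sf k N.

Definition power_sf (k : nat) : symfun := fun N => \sum_(i < N) 'X_i ^+ k.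

Definition power_part_sf (s : seq nat) : symfun := fun N =>
  \prod_(k <- s) power_sf k N.

Definition schur_sf (s : seq nat) : symfun := fun N =>
  \sum_(T : {ffun cell (s, [::]) -> 'I_N} | is_ssyt T) \prod_c 'X_(T c).

(* The (unique) coordinates of f in a basis B of the homogeneous symmetric
   functions of degree n; unspecified if f is not in their span. *)
Definition coords (n : nat) (B : seq nat -> symfun) (f : symfun) :
    {ffun intpart n -> rat} :=
  epsilon (inhabits [ffun=> 0])
    (fun b => forall N, f N = \sum_(la : intpart n) b la *: B (parts la) N).

(* The Hall inner product in degree n: the bilinear form for which the bases
   (m_la) and (h_la) are dual to each other. *)
Definition hall (n : nat) (f g : symfun) : rat :=
  \sum_(la : intpart n)
     coords n monomial_sf f la * coords n complete_part_sf g la.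

(* [:: B_0; ...; B_n], by sum_(k <= m) binom(m+1, k) B_k = 0 for m > 0. *)
Fixpoint bernoulli_seq (n : nat) : seq rat :=
  if n is m.+1 then
    let s := bernoulli_seq m in
    rcons s (- (n.+1%:R)^-1 * \sum_(k < n) 'C(n.+1, k)%:R * s`_k)
  else [:: 1].

Definition bernoulli (n : nat) : rat := (bernoulli_seq n)`_n.

Definition phi (n : nat) (la : intpart n) : rat :=
  (2 * n)`!%:R *
  \prod_(1 <= k < n.+1)
     let m := count_mem k (parts la) in
     (m`!%:R)^-1 *
     ((4 ^+ k * (4 ^+ k - 1) * bernoulli (2 * k)) /
      ((2 * k)%:R * (2 * k)`!%:R)) ^+ m.

Definition A_sf (n : nat) : symfun := fun N =>
  ((2 * n)`!%:R)^-1 *: \sum_(la : intpart n) `|phi la| *: power_part_sf (parts la) N.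

(* Main.v *)
Require Import Defs.
From mathcomp Require Import all_boot all_order all_algebra.
From mathcomp.multinomials Require Import mpoly.
From mathcomp Require Import all_fingroup all_field.
From mathcomp Require Import zify ring lra.
From Stdlib Require Import ClassicalEpsilon.

(* The exponential formula turns the power sum expansion of [A_n] into
   [sum_n A_n = prod_i sec (sqrt x_i)], since
   [log (sec (sqrt x)) = sum_k |4^k (4^k - 1) B_2k / (2k (2k)!)| x^k]. Hence the
   coordinate of [A_n] on [m_mu] is the value of [h_mu] under the specialization
   with [sum_k h_k t^k = sec (sqrt t)], that is [e_k = 1 / (2k)!], and the Hall
   product of [A_n] with [s_la] is the value of [s_la]. By the dual Jacobi-Trudi
   identity this is [det (1 / (2 la'_i - 2 i + 2 j)!)], which by Aitken's formula is
   [f^rho / (2n)!]. Both determinantal formulas are obtained by building a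
   tableau one entry value at a time: the determinant, as a function of the
   shifted inner shape, satisfies the same transfer recursion, and vanishes when
   two shifted parts coincide. The specialization is realized as evaluation at
   a point with coordinates in [algC], so that it applies to any expansion of
   [s_la] in the [h_mu]. *)

Set Implicit Arguments.
Unset Strict Implicit.
Unset Printing Implicit Defensive.

Import Order.TTheory GRing.Theory Num.Theory.
Local Open Scope ring_scope.

(** * Determinants as sums over chains *)

(** The staircase inner shape of [rho] is what makes the two determinants meet. With 0-based
    indices, adding the usual shift [l-1-i] to [sigma_i] and [tau_i] gives twice [la'_i + (l-1-i)]
    and twice [l-1-i]. Aitken's matrix therefore carries [1/(2d)!] exactly where the dual
    Jacobi-Trudi matrix carries [e_d]. The two tableau counts share one bijection: semistandard
    tableaux of [la] read by columns and standard tableaux of [rho] read by rows are both strict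
    along lines and at least weak across them. Only the weights of a step [A] differ: [x_k^|A|] in
    one case, the indicator of [|A| = 1] in the other. On the analytic side, the absolute values in
    [phi] hide the sign pattern of the Bernoulli numbers. It is derived by passing from them to
    [tanh], then to [tan], whose differential equation forces nonnegative coefficients. *)

Section Chains.
Variable l : nat.
Implicit Types (a b : {ffun 'I_l -> nat}) (A : {set 'I_l}) (s : seq {set 'I_l}).

Definition strictly_decreasing b : bool :=
  [forall i : 'I_l, forall j : 'I_l, (i < j)%N ==> (b j < b i)%N].

Lemma strictly_decreasingP b :
  reflect (forall i j : 'I_l, (i < j)%N -> (b j < b i)%N)
          (strictly_decreasing b).
Proof.
by apply: (iffP 'forall_'forall_implyP).
Qed.

Definition incr_on b A : {ffun 'I_l -> nat} := [ffun i => b i + (i \in A)]%N.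

(** Every vector reached after a step is tested for strict decrease; the start [b] is not, and its
    strictness is supplied separately. *)
Fixpoint is_chain a b s : bool :=
  if s is A :: s' then
    strictly_decreasing (incr_on b A) && is_chain a (incr_on b A) s'
  else b == a.

(** Unrolled form: after [k] steps, coordinate [i] has grown by the number of sets among the first
    [k] that contain [i]. Fillings are compared with these counts. *)
Lemma is_chainP a b s :
  reflect ((forall k, (0 < k <= size s)%N -> forall i j : 'I_l, (i < j)%N ->
              (b j + count (fun A => j \in A) (take k s)
                 < b i + count (fun A => i \in A) (take k s))%N)
           /\ forall i, (b i + count (fun A => i \in A) s)%N = a i)
          (is_chain a b s).
Proof.
elim: s b => [|A s IHs] b /=.
  apply: (iffP eqP) => [-> | [_ ab]]; first by split=> [[] // | i]; rewrite addn0.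
  by apply/ffunP => i; rewrite -ab addn0.
have cS i r : (b i + ((i \in A) + r))%N = (incr_on b A i + r)%N.
  by rewrite ffunE addnA.
apply: (iffP andP) => [[/strictly_decreasingP dS /IHs[ds es]] | [ds es]].
  split=> [k /andP[k0 le_k] i j lt_ij | i]; last by rewrite cS es.
  case: k k0 le_k => [|[|k]] //= _ le_k; rewrite !cS.
    by rewrite take0 /= !addn0 dS.
  by apply: ds.
split.
  apply/strictly_decreasingP => i j lt_ij.
  have := ds 1%N isT i j lt_ij; rewrite /= take0 !cS /= !addn0 //.
apply/IHs; split=> [k /andP[_ le_k] i j lt_ij | i]; last by rewrite -cS es.
by have := ds k.+1 le_k i j lt_ij; rewrite /= !cS.
Qed.

(** Each coordinate rises by at most one and [b i > b j] beforehand, so strictness at [i < j] can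
    only fail through equality. *)
Lemma eq_entries_of_not_strict b A : strictly_decreasing b ->
  ~~ strictly_decreasing (incr_on b A) ->
  exists i, exists2 j, i != j & incr_on b A i = incr_on b A j.
Proof.
move=> /strictly_decreasingP db /forallPn[i /forallPn[j]].
rewrite negb_imply => /andP[lt_ij]; rewrite -leqNgt => le_ij.
exists i, j; first by rewrite neq_ltn lt_ij.
apply/eqP; rewrite eqn_leq le_ij /= !ffunE.
move: (db _ _ lt_ij); case: (i \in A); case: (j \in A) => /=; lia.
Qed.

Lemma big_tuple_cons (R : nmodType) (A : finType) N (F : N.+1.-tuple A -> R) :
  \sum_t F t = \sum_x \sum_(t : N.-tuple A) F [tuple of x :: t].
Proof.
rewrite pair_big /=.
rewrite (reindex (fun p : A * N.-tuple A => [tuple of p.1 :: p.2])) //=.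
exists (fun t : N.+1.-tuple A => (thead t, [tuple of behead t])) => [[x t] _ | t _] /=.
  by rewrite theadE; congr pair; apply: val_inj.
by rewrite [RHS]tuple_eta; apply: val_inj.
Qed.

(* A chain-counting function is determined by its transfer recursion; the
   vanishing on repeated entries absorbs the steps that leave the chamber of
   strictly decreasing vectors. *)
Lemma sum_chains (R : comNzRingType) a N (w : nat -> {set 'I_l} -> R)
    (D : nat -> {ffun 'I_l -> nat} -> R) :
  (forall b, strictly_decreasing b -> D N b = (b == a)%:R) ->
  (forall k b i j, i != j -> b i = b j -> D k b = 0) ->
  (forall k b, (k < N)%N -> D k b = \sum_A w k A * D k.+1 (incr_on b A)) ->
  forall b, strictly_decreasing b ->
  D 0%N b = \sum_(t : N.-tuple {set 'I_l} | is_chain a b t)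
              \prod_(k < N) w k (tnth t k).
Proof.
move=> D0 Deq DS b db.
have gen r k b' : (k + r)%N = N -> strictly_decreasing b' ->
    D k b' = \sum_(t : r.-tuple {set 'I_l} | is_chain a b' t)
               \prod_(i < r) w (k + i)%N (tnth t i).
  elim: r k b' => [|r IHr] k b' eN db'.
    rewrite -eN addn0 in D0; rewrite D0 //.
    rewrite big_mkcond (eq_bigr (fun=> (b' == a)%:R)) => [|t _].
      by rewrite sumr_const card_tuple expn0.
    by rewrite (tuple0 t) big_ord0 /=; case: ifP.
  rewrite DS -?eN ?addnS ?ltnS ?leq_addr // [RHS]big_mkcond big_tuple_cons.
  apply: eq_bigr => A _ /=.
  case: (boolP (strictly_decreasing (incr_on b' A))) => [dS|ndS] /=; last first.
    have [i [j neq_ij eq_ij]] := eq_entries_of_not_strict db' ndS.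
    by rewrite (Deq _ _ _ _ neq_ij eq_ij) mulr0 big1.
  rewrite IHr ?addSnnS // big_distrr big_mkcond; apply: eq_bigr => t _ /=.
  case: ifP => // _; rewrite big_ord_recl addn0; congr (_ * _).
  by apply: eq_bigr => i _; rewrite /bump addSnnS tnthS.
by rewrite (gen N).
Qed.

End Chains.

(** * Kernel determinants and elementary symmetric polynomials *)

Section Determinants.
Variables (R : comNzRingType) (l : nat).
Implicit Types (a b : {ffun 'I_l -> nat}) (A : {set 'I_l}) (xs : seq R).

(** Rows follow the inner vector [b], so a transfer step acts on whole rows and equal entries of [b]
    give equal rows. *)
Definition kernel_mx (g : nat -> nat -> R) a b : 'M[R]_l :=
  \matrix_(j, i) g (a i) (b j).

Lemma det_kernel_eq0 g a b i j :
  i != j -> b i = b j -> \det (kernel_mx g a b) = 0.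
Proof.
move=> neq_ij eq_ij; apply: determinant_alternate neq_ij _ => k.
by rewrite !mxE eq_ij.
Qed.

Lemma sorted_codom_strictly_decreasing b :
  strictly_decreasing b -> sorted gtn [seq b i | i <- enum 'I_l].
Proof.
move=> /strictly_decreasingP db; rewrite sorted_map.
have := iota_ltn_sorted 0 l; rewrite -val_enum_ord sorted_map.
by apply: sub_sorted => i j /= /db.
Qed.

Lemma strictly_decreasing_perm_inj a b (s : 'S_l) :
  strictly_decreasing a -> strictly_decreasing b ->
  (forall j, a (s j) = b j) -> b = a.
Proof.
move=> da db eq_ab.
have /eq_in_map eq_m : [seq b i | i <- enum 'I_l] = [seq a i | i <- enum 'I_l].
  apply: (@irr_sorted_eq _ gtn); rewrite ?sorted_codom_strictly_decreasing //.
  - by move=> y x z /= lt_yx lt_zy; apply: ltn_trans lt_yx.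
  - by move=> x; rewrite /= ltnn.
  move=> k; apply/mapP/mapP => [] [i _ ->]; first by exists (s i); rewrite ?mem_enum.
  by exists ((s^-1)%g i); rewrite ?mem_enum // -eq_ab permKV.
by apply/ffunP => i; apply: eq_m; rewrite mem_enum.
Qed.

(** Initial condition of the transfer recursion: for [a != b] every permutation meets a mismatched
    index, which kills its term. *)
Lemma det_kernel_id a b : strictly_decreasing a -> strictly_decreasing b ->
  \det (kernel_mx (fun p q => (p == q)%:R) a b) = (b == a)%:R.
Proof.
move=> da db; case: (altP (b =P a)) => [-> | neq_ba].
  rewrite (_ : kernel_mx _ _ _ = 1%:M) ?det1 //.
  apply/matrixP=> j i; rewrite !mxE; congr (_ %:R); congr nat_of_bool.
  move/strictly_decreasingP: da => da; apply/eqP/eqP => [e | -> //].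
  by case: (ltngtP i j) => [/da | /da | /val_inj ->] //; rewrite e ltnn.
apply: big1 => s _; have [/existsP[j neq_j] | /existsPn eq_j] :=
  boolP [exists j, a (s j) != b j].
  by rewrite (bigD1 j) //= mxE (negPf neq_j) mul0r mulr0.
case/eqP: neq_ba; apply: strictly_decreasing_perm_inj (s) da db _ => j.
by apply/eqP; have := eq_j j; rewrite negbK.
Qed.

(* [shifted_esym xs p q] is the elementary symmetric polynomial of degree
   [p - q] in [xs], and 0 when [p < q], see [shifted_esymE]. *)
Fixpoint shifted_esym xs (p q : nat) : R :=
  if xs is x :: xs' then shifted_esym xs' p q + x * shifted_esym xs' p q.+1
  else (p == q)%:R.

Lemma shifted_esymE xs p q : shifted_esym xs p q =
  if (q <= p)%N then (\prod_(x <- xs) (1 + x *: 'X))`_(p - q) else 0.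
Proof.
elim: xs p q => [|x xs IHxs] p q /=.
  rewrite big_nil coef1 subn_eq0 eqn_leq [(q <= p)%N in RHS]leq_eqVlt.
  by case: ltngtP.
rewrite !IHxs big_cons mulrDl mul1r -scalerAl coefD coefZ coefXM subn_eq0 subnS.
by case: ltngtP => //= _; rewrite mulr0 addr0.
Qed.

(** Multilinearity: row [j] is the row for [b j] plus [x] times the row for [b j + 1], and [A]
    collects the rows where the second summand is chosen. *)
Lemma det_shifted_esym_cons x xs a b :
  \det (kernel_mx (shifted_esym (x :: xs)) a b) =
  \sum_(A : {set 'I_l}) x ^+ #|A| * \det (kernel_mx (shifted_esym xs) a (incr_on b A)).
Proof.
under [RHS]eq_bigr do rewrite /determinant big_distrr.
rewrite exchange_big; apply: eq_bigr => s _ /=.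
under eq_bigr do rewrite mxE /= addrC.
rewrite bigA_distr big_distrr; apply: eq_bigr => A _ /=.
rewrite [RHS]mulrCA; congr (_ * _).
rewrite -prodr_const [X in _ = X * _]big_mkcond -big_split; apply: eq_bigr => j _ /=.
by rewrite !mxE ffunE; case: ifP => _; rewrite ?addn1 ?addn0 ?mul1r.
Qed.

Lemma det_shifted_esym_chains N xs a b : size xs = N ->
  strictly_decreasing a -> strictly_decreasing b ->
  \det (kernel_mx (shifted_esym xs) a b) =
  \sum_(t : N.-tuple {set 'I_l} | is_chain a b t)
     \prod_(k < N) xs`_k ^+ #|tnth t k|.
Proof.
move=> <- da db.
pose D k c := \det (kernel_mx (shifted_esym (drop k xs)) a c).
rewrite -[LHS]/(\det (kernel_mx (shifted_esym xs) a b)) -[in LHS](drop0 xs).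
apply: (@sum_chains l R a (size xs) (fun k A => xs`_k ^+ #|A|) D) => //.
- by move=> c dc; rewrite /D drop_size det_kernel_id.
- by move=> k c i j; apply: det_kernel_eq0.
by move=> k c lt_k; rewrite /D (drop_nth 0) // det_shifted_esym_cons.
Qed.

End Determinants.

(** * Aitken's factorial determinant *)

Section FactorialDeterminant.
Variable l : nat.
Implicit Types (a b : {ffun 'I_l -> nat}) (A : {set 'I_l}).

(** The test encodes [1/d! = 0] for [d < 0]; truncated subtraction alone would give [1/0!] there. *)
Definition inv_fact (p q : nat) : rat := if (q <= p)%N then (p - q)`!%:R^-1 else 0.

Lemma inv_fact_S p q : inv_fact p q.+1 = (p%:R - q%:R) * inv_fact p q.
Proof.
rewrite /inv_fact; case: (ltngtP q p) => [lt_qp | | ->]; rewrite ?mulr0 ?subrr ?mul0r //.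
rewrite -natrB ?(ltnW lt_qp) // subnS.
have: (0 < p - q)%N by rewrite subn_gt0.
case: (p - q)%N => //= d _; rewrite factS natrM invfM mulrA divff ?mul1r //.
by rewrite pnatr_eq0.
Qed.

(** In the term of a permutation [s], raising [b i] multiplies the product by [a (s i) - b i]. These
    factors add up to [M], whatever [s] is. *)
Lemma sum_det_inv_fact_incr a b M :
  (\sum_i a i = \sum_i b i + M)%N ->
  M%:R * \det (kernel_mx inv_fact a b) =
  \sum_i \det (kernel_mx inv_fact a (incr_on b [set i])).
Proof.
move=> sum_ab; rewrite /determinant exchange_big big_distrr; apply: eq_bigr => s _ /=.
rewrite -big_distrr mulrCA /=; congr (_ * _).
have -> : M%:R = \sum_i ((a (s i))%:R - (b i)%:R) :> rat.
  rewrite sumrB -!natr_sum -(reindex_inj (@perm_inj _ s) (P := xpredT) (F := a)) /=.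
  by rewrite sum_ab natrD addrC addKr.
rewrite big_distrl; apply: eq_bigr => i _ /=.
rewrite (bigD1 i) //= [RHS](bigD1 i) //= !mxE mulrA -inv_fact_S ffunE inE eqxx addn1.
congr (_ * _); apply: eq_bigr => j neq_ji.
by rewrite !mxE ffunE inE (negPf neq_ji) addn0.
Qed.

Lemma det_inv_fact_chains M a b :
  strictly_decreasing a -> strictly_decreasing b ->
  (\sum_i a i = \sum_i b i + M)%N ->
  M`!%:R * \det (kernel_mx inv_fact a b) =
  \sum_(t : M.-tuple {set 'I_l} | is_chain a b t)
     \prod_(k < M) (#|tnth t k| == 1%N)%:R.
Proof.
move=> da db sum_ab.
(* Without the size guard the last level would not be an indicator, since [inv_fact p q] is nonzero
   also for [q < p]. *)
pose D k (c : {ffun 'I_l -> nat}) := if (\sum_i a i == \sum_i c i + (M - k))%N then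
  (M - k)`!%:R * \det (kernel_mx inv_fact a c) else 0.
transitivity (D 0%N b); first by rewrite /D subn0 sum_ab eqxx.
apply: (@sum_chains l _ a M (fun k A => (#|A| == 1%N)%:R) D) => //.
- move=> c dc; rewrite /D subnn mul1r addn0 -(det_kernel_id rat da dc).
  case: eqP => [sum_ac | ne_ac].
    apply: eq_bigr => s _; congr (_ * _).
    have [/forallP eq_j | /forallPn[j ne_j]] := boolP [forall j, a (s j) == c j].
      by apply: eq_bigr => j _; rewrite !mxE (eqP (eq_j j)) eqxx /inv_fact leqnn subnn.
    rewrite [RHS](bigD1 j) //= mxE (negPf ne_j) mul0r.
    (* The sums being equal, [c j <= a (s j)] for all [j] would force equality throughout, so a
       mismatch makes some factor vanish. *)
    have [/forallP le_j | /forallPn[i lt_i]] := boolP [forall j, c j <= a (s j)]%N.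
      have := @leqif_sum _ xpredT (fun j => c j == a (s j)) c (fun j => a (s j)).
      case=> [i _|_]; first by split; first exact: le_j.
      rewrite -(reindex_inj (@perm_inj _ s) (P := xpredT) (F := a)) /= sum_ac eqxx.
      by move/esym/forallP/(_ j)/eqP => e; rewrite e eqxx in ne_j.
    by rewrite (bigD1 i) //= mxE /inv_fact (negPf lt_i) mul0r.
  rewrite (det_kernel_id rat da dc); case: eqP => // eq_ca.
  by rewrite eq_ca in ne_ac.
- by move=> k c i j ne_ij eq_ij; rewrite /D (det_kernel_eq0 _ _ ne_ij) // mulr0 if_same.
move=> k c lt_k; rewrite /D.
have sum_incr i : (\sum_j incr_on c [set i] j = (\sum_j c j).+1)%N.
  under eq_bigr do rewrite ffunE.
  rewrite big_split /= [X in (_ + X)%N](bigD1 i) //= inE eqxx.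
  by rewrite [X in (true + X)%N]big1 ?addn1 // => j /negPf; rewrite inE => ->.
rewrite (eq_bigr (fun A => if #|A| == 1%N then D k.+1 (incr_on c A) else 0));
  last by move=> A _; case: eqP; rewrite ?mul1r ?mul0r.
rewrite -big_mkcond (eq_bigl (mem [set [set i] | i in 'I_l])) => [|A]; last first.
  apply/cards1P/imsetP => [[i ->] | [i _ ->]]; [by exists i | by exists i].
rewrite big_imset /= => [|i j _ _]; last exact: set1_inj.
rewrite /D; under [RHS]eq_bigr do rewrite sum_incr addSnnS subnSK //.
case: ifP => [/eqP sum_ac | _]; last by rewrite big1.
rewrite -big_distrr /= -(sum_det_inv_fact_incr sum_ac) mulrA -natrM; congr (_%:R * _).
by rewrite -(subnSK lt_k) factS mulnC.
Qed.

End FactorialDeterminant.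

(** * Tableaux as chains *)

Definition shifted (l : nat) (f : 'I_l -> nat) : {ffun 'I_l -> nat} :=
  [ffun i : 'I_l => f i + (l - i.+1)]%N.

(** The staircase drops by exactly one between neighbours, so strict decrease after the shift is
    weak decrease before it; induction on [j] extends this to all pairs. *)
Lemma shifted_decreasingP (l : nat) (f : 'I_l -> nat) :
  (forall i j : 'I_l, (i < j)%N -> (f j + (l - j.+1) < f i + (l - i.+1))%N) <->
  (forall i j : 'I_l, (i < j)%N -> (f j <= f i)%N).
Proof.
split=> [df i j | df i j lt_ij]; last first.
  by have := df i j lt_ij; have := ltn_ord j; lia.
case: j => j; elim: j => [|j IHj] lt_j //=; rewrite ltnS leq_eqVlt => /orP[/eqP eij | lt_ij].
  have lt_ij : (i < Ordinal lt_j)%N by rewrite /= eij.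
  by have := df _ _ lt_ij; have := lt_j; rewrite /=; lia.
apply: leq_trans (IHj (ltnW lt_j) lt_ij).
have := df (Ordinal (ltnW lt_j)) (Ordinal lt_j); rewrite /= ltnSn => /(_ isT).
by have := lt_j; lia.
Qed.

Section Tableaux.
Variables (l N : nat) (C : finType) (line : C -> 'I_l) (pos : C -> nat).
Variables (mu la : 'I_l -> nat).
Hypothesis pos_range : forall c, (mu (line c) <= pos c < la (line c))%N.
Hypothesis cell_ex :
  forall i p, (mu i <= p < la i)%N -> exists2 c, line c = i & pos c = p.
Hypothesis cell_inj : forall c d, line c = line d -> pos c = pos d -> c = d.
Hypothesis mu_dec : forall i j : 'I_l, (i < j)%N -> (mu j <= mu i)%N.
Hypothesis la_dec : forall i j : 'I_l, (i < j)%N -> (la j <= la i)%N.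
Hypothesis mu_le_la : forall i, (mu i <= la i)%N.
Implicit Types (T : {ffun C -> 'I_N}) (s : N.-tuple {set 'I_l}).

(** [line] will be the column for semistandard tableaux and the row for standard ones. *)
Definition line_strict T : bool :=
  [forall c, forall d,
     ((line c == line d) && (pos c < pos d)%N ==> (T c < T d)%N) &&
     ((pos c == pos d) && (line c < line d)%N ==> (T c <= T d)%N)].

Lemma line_strictP T :
  reflect ((forall c d, line c = line d -> (pos c < pos d)%N -> (T c < T d)%N) /\
           (forall c d, pos c = pos d -> (line c < line d)%N -> (T c <= T d)%N))
          (line_strict T).
Proof.
apply: (iffP 'forall_'forall_andP) => [sT | [sT wT] c d].
  split=> c d e lt_cd; have [/implyP h1 /implyP h2] := sT c d.
    by apply: h1; rewrite e eqxx.
  by apply: h2; rewrite e eqxx.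
by split; apply/implyP => /andP[/eqP e lt_cd]; [apply: sT | apply: wT].
Qed.

Definition steps T : N.-tuple {set 'I_l} :=
  [tuple [set line c | c in [set c | T c == k]] | k < N].

Lemma line_card i p : (mu i <= p <= la i)%N ->
  #|[set c | (line c == i) && (pos c < p)%N]| = (p - mu i)%N.
Proof.
elim: p => [|p IHp] /andP[le_mu le_la].
  rewrite sub0n; apply/eqP; rewrite cards_eq0; apply/eqP/setP => c.
  by rewrite !inE ltn0 andbF.
case: (ltngtP (mu i) p.+1) le_mu => // [lt_mu _ | e_mu _]; last first.
  rewrite -e_mu subnn; apply/eqP; rewrite cards_eq0; apply/eqP/setP => c.
  rewrite !inE; apply/negP => /andP[/eqP e]; have := pos_range c; rewrite e; lia.
have [c ec ep] : exists2 c, line c = i & pos c = p by apply: cell_ex; lia.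
rewrite (_ : [set _ | _] = c |: [set c | (line c == i) && (pos c < p)%N]).
  by rewrite cardsU1 inE ec ep eqxx ltnn IHp //=; lia.
apply/setP => d; rewrite !inE; case: (altP (d =P c)) => [-> | ne_dc] /=.
  by rewrite ec ep eqxx leqnn.
case: eqP => //= ed; rewrite ltnS leq_eqVlt orb_idl // => /eqP pd.
by case/eqP: ne_dc; apply: cell_inj; rewrite ?ec ?ep.
Qed.

Lemma card_cells : (#|C| = \sum_i (la i - mu i))%N.
Proof.
rewrite -sum1_card (partition_big line xpredT) //=; apply: eq_bigr => i _.
rewrite -(@line_card i (la i)) ?leqnn ?mu_le_la // -sum1_card.
apply: eq_bigl => c; rewrite inE; case: eqP => //= <-.
by have /andP[] := pos_range c.
Qed.

Section FromTableau.
Variable T : {ffun C -> 'I_N}.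
Hypothesis T_strict : line_strict T.

Lemma card_fiber k : #|tnth (steps T) k| = #|[set c | T c == k]|.
Proof.
rewrite tnth_mktuple card_in_imset // => c d.
have [sT _] := line_strictP _ T_strict.
rewrite !inE => /eqP ec /eqP ed e_cd; apply: cell_inj => //.
by case: (ltngtP (pos c) (pos d)) => // [/(sT _ _ e_cd) | /(sT _ _ (esym e_cd))];
  rewrite ec ed ltnn.
Qed.

Lemma count_steps i k : (k <= N)%N ->
  count (fun A : {set 'I_l} => i \in A) (take k (steps T)) =
  #|[set c | (line c == i) && (T c < k)%N]|.
Proof.
have [sT _] := line_strictP _ T_strict.
elim: k => [|k IHk] lt_k.
  rewrite take0; apply/esym/eqP; rewrite cards_eq0; apply/eqP/setP => c.
  by rewrite !inE ltn0 andbF.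
rewrite (take_nth set0) ?size_tuple // -cats1 count_cat IHk ?(ltnW lt_k) //= addn0.
have -> : nth set0 (steps T) k = tnth (steps T) (Ordinal lt_k).
  by rewrite (tnth_nth set0).
rewrite tnth_mktuple.
case: imsetP => [[c] | no_c]; last first.
  rewrite addn0; apply: eq_card => c; rewrite !inE ltnS [(T c <= k)%N]leq_eqVlt.
  case: eqP => //= ec; rewrite orb_idl // => /eqP eT; case: no_c.
  by exists c; rewrite ?inE //; apply/eqP/val_inj.
rewrite inE => /eqP eT ec; rewrite addn1.
rewrite [RHS](_ : _ = #|c |: [set d | (line d == i) && (T d < k)%N]|).
  by rewrite cardsU1 inE eT /= ltnn andbF.
apply: eq_card => d; rewrite !inE; case: (altP (d =P c)) => [-> | ne_dc] /=.
  by rewrite -ec eqxx eT leqnn.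
case: eqP => //= ed; rewrite ltnS [(T d <= k)%N]leq_eqVlt orb_idl // => /eqP Td.
case/eqP: ne_dc; apply: cell_inj; first by rewrite ed.
have e_dc : line d = line c by rewrite ed.
by case: (ltngtP (pos d) (pos c)) => // [/(sT _ _ e_dc) | /(sT _ _ (esym e_dc))];
  rewrite eT Td /= ltnn.
Qed.

(** Entries increase along a line, so the cells with entry below [k] form its initial segment, whose
    length is the count. The steps thus determine [T]. *)
Lemma lt_tableau c k : (k <= N)%N ->
  (T c < k)%N =
  (pos c < mu (line c) + count (fun A : {set 'I_l} => line c \in A) (take k (steps T)))%N.
Proof.
have [sT _] := line_strictP _ T_strict; have /andP[le_mu lt_la] := pos_range c.
move=> le_k; rewrite count_steps //; set n := #|_|.
case: (ltnP (T c) k) => [lt_Tk | le_kT]; apply/esym; last first.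
  apply/negbTE; rewrite -leqNgt.
  suff: (n <= pos c - mu (line c))%N by lia.
  rewrite -line_card ?le_mu ?(ltnW lt_la) //; apply: subset_leq_card.
  apply/subsetP => d; rewrite !inE => /andP[/eqP ed lt_d]; rewrite ed eqxx /=.
  rewrite ltnNge leq_eqVlt; apply/negP => /orP[/eqP ep | /(sT c d (esym ed)) lt_cd].
    by have e_cd : c = d by [apply: cell_inj]; move: lt_d; rewrite -e_cd; lia.
  by lia.
suff: ((pos c).+1 - mu (line c) <= n)%N by lia.
rewrite -line_card; last by lia.
apply: subset_leq_card; apply/subsetP => d; rewrite !inE ltnS => /andP[/eqP ed].
rewrite ed eqxx /= leq_eqVlt => /orP[/eqP ep | /(sT d c ed) lt_dc]; last by lia.
by rewrite (cell_inj ed ep).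
Qed.

Lemma total_steps i : (mu i + count (fun A : {set 'I_l} => i \in A) (steps T))%N = la i.
Proof.
rewrite -[tval _]take_size size_tuple count_steps //.
rewrite (eq_card (B := [set c | (line c == i) && (pos c < la i)%N])) => [|c].
  by rewrite line_card ?leqnn ?mu_le_la // subnKC.
by rewrite !inE ltn_ord; case: eqP => //= <-; have /andP[] := pos_range c.
Qed.

Lemma steps_chain : is_chain (shifted la) (shifted mu) (steps T).
Proof.
apply/is_chainP; split=> [k | i]; rewrite ?size_tuple.
  move=> /andP[_ le_k] i j lt_ij; rewrite !ffunE !(addnAC _ (_ - _))%N.
  move: i j lt_ij; apply/shifted_decreasingP => i j lt_ij.
  (* If line [j] got ahead of line [i], position [ni] would hold an entry below [k] in line [j] and
     one at least [k] in line [i], against weakness across lines. *)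
  rewrite leqNgt; apply/negP; set ni := (mu i + _)%N; set nj := (mu j + _)%N => lt_n.
  have le_ni : (mu i <= ni)%N by apply: leq_addr.
  have le_nj : (nj <= la j)%N.
    by rewrite -total_steps leq_add2l -[X in (_ <= count _ X)%N](cat_take_drop k)
      count_cat leq_addr.
  have [c ec pc] : exists2 c, line c = i & pos c = ni.
    by apply: cell_ex; have := la_dec lt_ij; lia.
  have [d ed pd] : exists2 d, line d = j & pos d = ni.
    by apply: cell_ex; have := mu_dec lt_ij; lia.
  have [_ wT] := line_strictP _ T_strict.
  have := wT c d; rewrite pc pd ec ed => /(_ erefl lt_ij).
  have := lt_tableau c le_k; have := lt_tableau d le_k.
  rewrite ec ed pc pd -/ni -/nj ltnn lt_n; lia.
by rewrite !ffunE addnAC total_steps.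
Qed.

End FromTableau.

Lemma steps_inj : {in line_strict &, injective steps}.
Proof.
move=> T T' sT sT' eq_s; apply/ffunP => c; apply/val_inj/eqP; rewrite eqn_leq.
have lt_iff k : (k <= N)%N -> (T c < k)%N = (T' c < k)%N.
  by move=> le_k; rewrite !lt_tableau // eq_s.
have := lt_iff (T c).+1 (ltn_ord _); have := lt_iff (T' c).+1 (ltn_ord _).
by rewrite !ltnS !leqnn => -> <-.
Qed.

Section FromChain.
Variable s : N.-tuple {set 'I_l}.
Hypothesis s_chain : is_chain (shifted la) (shifted mu) s.

Definition level (i : 'I_l) (k : nat) : nat :=
  (mu i + count (fun A : {set 'I_l} => i \in A) (take k s))%N.

Lemma level_dec (i j : 'I_l) k : (k <= N)%N -> (i < j)%N -> (level j k <= level i k)%N.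
Proof.
(* A chain does not test its start, so level 0 relies on [mu_dec]. *)
case: k => [|k] lt_k; first by rewrite /level take0 !addn0 => /mu_dec.
move: i j; apply/shifted_decreasingP => i j lt_ij.
have /is_chainP[/(_ k.+1)] := s_chain.
by rewrite size_tuple => /(_ lt_k i j lt_ij); rewrite !ffunE !(addnAC _ (_ - _))%N.
Qed.

Lemma level_last i : level i N = la i.
Proof.
have /is_chainP[_ /(_ i)] := s_chain; rewrite !ffunE addnAC => /addIn <-.
by rewrite /level take_oversize ?size_tuple.
Qed.

Lemma levelS i (k : 'I_N) : level i k.+1 = (level i k + (i \in tnth s k))%N.
Proof.
rewrite /level (take_nth set0) ?size_tuple // -cats1 count_cat /= addn0 addnA.
by rewrite (tnth_nth set0).
Qed.

Lemma level_mono i : {homo level i : k k' / (k <= k')%N}.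
Proof.
move=> k k' le_k; rewrite leq_add2l -(subnKC le_k) takeD count_cat; exact: leq_addr.
Qed.

(** The entry of a cell is the step at which the level of its line passes it; levels run from [mu]
    to [la], so there is one. *)
Lemma ex_entry c : exists k : 'I_N, (level (line c) k <= pos c < level (line c) k.+1)%N.
Proof.
have /andP[le_mu lt_la] := pos_range c.
have ex : exists k, (pos c < level (line c) k)%N by exists N; rewrite level_last.
case: (ex_minnP ex) => k lt_k min_k.
have le_kN : (k <= N)%N by apply: min_k; rewrite level_last.
case: k => [|k] in lt_k min_k le_kN *.
  by move: lt_k; rewrite /level take0 addn0; lia.
by exists (Ordinal le_kN); rewrite lt_k andbT leqNgt; apply/negP => /min_k; rewrite ltnn.
Qed.

(** Strict along a line because a step raises a level by at most one, weak across lines because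
    levels decrease with the line index. *)
Lemma chain_tableau : exists2 T, line_strict T & steps T = s.
Proof.
have /fin_all_exists[t tP] := ex_entry.
pose T := [ffun c => t c]; have TP c : (level (line c) (T c) <= pos c < level (line c) (T c).+1)%N.
  by rewrite ffunE tP.
have lt_T c k : (T c < k)%N = (pos c < level (line c) k)%N.
  have /andP[le_p lt_p] := TP c.
  apply/idP/idP => [/(level_mono (line c)) | lt_pk]; first exact: leq_trans.
  rewrite ltnNge; apply/negP => /(level_mono (line c)); lia.
exists T.
  apply/line_strictP; split=> c d e lt_cd.
    rewrite ltnNge; apply/negP => le_dc.
    have := lt_T d (T c).+1; rewrite ltnS le_dc => /esym.
    by have := TP c; rewrite e levelS; case: (_ \in _) => /=; lia.
  rewrite -ltnS lt_T e; have := lt_T d (T d).+1; rewrite ltnSn => /esym h.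
  by apply: leq_trans h (level_dec _ lt_cd).
apply: eq_from_tnth => k; rewrite tnth_mktuple; apply/setP => i.
apply/imsetP/idP => [[c] | in_i].
  rewrite inE => /eqP <- ->; have := TP c; rewrite levelS.
  by case: (_ \in _) => //=; lia.
have [c ec pc] : exists2 c, line c = i & pos c = level i k.
  apply: cell_ex; rewrite leq_addr -level_last /=.
  by apply: leq_trans (level_mono i (ltn_ord k)); rewrite levelS in_i addn1.
exists c; rewrite // inE; apply/eqP/val_inj/eqP; rewrite eqn_leq.
by rewrite -ltnS lt_T [(k <= _)%N]leqNgt lt_T ec pc ltnn andbT levelS in_i addn1.
Qed.

End FromChain.

Lemma sum_tableaux_chains (R : nmodType) (F : N.-tuple {set 'I_l} -> R) :
  \sum_(T | line_strict T) F (steps T) =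
  \sum_(s : N.-tuple {set 'I_l} | is_chain (shifted la) (shifted mu) s) F s.
Proof.
rewrite -(big_imset F (h := steps) (A := line_strict)); last exact: steps_inj.
apply: eq_bigl => s; apply/imsetP/idP => [[T sT ->] | cs].
  exact: steps_chain.
by have [T sT eT] := chain_tableau cs; exists T; rewrite ?eT.
Qed.

End Tableaux.

(** * The exponential formula *)

Definition partitions (n : nat) : seq (seq nat) := [seq parts la | la : intpart n].

Lemma mem_partitions n s : (s \in partitions n) = is_part n s.
Proof.
apply/imageP/idP => [[la _ ->] | /intpartP[la <-]]; first exact: partsP.
by exists la.
Qed.

Lemma uniq_partitions n : uniq (partitions n).
Proof. by rewrite map_inj_uniq ?enum_uniq //; apply: parts_inj. Qed.

Lemma big_partitions (R : nmodType) n (F : seq nat -> R) :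
  \sum_(s <- partitions n) F s = \sum_(la : intpart n) F (parts la).
Proof. by rewrite big_image. Qed.

Lemma geq_trans : transitive geq.
Proof. by move=> y x z /= le_yx le_zy; apply: leq_trans le_yx. Qed.

Lemma geq_total : total geq.
Proof. by move=> x y; rewrite /= leq_total. Qed.

Lemma is_part_perm_inj n n' s t : is_part n s -> is_part n' t -> perm_eq s t -> s = t.
Proof.
move=> /and3P[ss _ _] /and3P[st _ _]; apply: (sorted_eq geq_trans) => //.
by move=> x y /= le_xy; apply/eqP; rewrite eqn_leq andbC.
Qed.

Lemma part_bounds n s k : is_part n s -> k \in s -> (0 < k <= n)%N.
Proof.
move=> /and3P[_ n0 /eqP <-] ks; rewrite lt0n (memPn n0) // /=.
by rewrite (perm_sumn (perm_to_rem ks)) /= leq_addr.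
Qed.

Definition insert_part (k : nat) (t : seq nat) : seq nat := sort geq (k :: t).

Lemma count_insert_part j k t :
  count_mem j (insert_part k t) = ((j == k) + count_mem j t)%N.
Proof. by rewrite count_sort /= eq_sym. Qed.

Lemma is_part_insert n k t : (0 < k)%N -> is_part n t -> is_part (k + n) (insert_part k t).
Proof.
move=> k0 /and3P[_ n0 /eqP st]; apply/and3P; split.
- by rewrite sort_sorted //; apply: geq_total.
- by rewrite mem_sort inE negb_or n0 eq_sym -lt0n k0.
by rewrite (perm_sumn (permEl (perm_sort _ _))) /= st.
Qed.

Lemma partitions_containing n k : (0 < k <= n)%N ->
  perm_eq [seq s <- partitions n | k \in s]
          [seq insert_part k t | t <- partitions (n - k)].
Proof.
move=> /andP[k0 le_kn]; apply: uniq_perm.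
- by rewrite filter_uniq ?uniq_partitions.
- rewrite map_inj_in_uniq ?uniq_partitions // => t t'.
  rewrite !mem_partitions => pt pt' e; apply: (is_part_perm_inj pt pt').
  by rewrite -(perm_cons k) -[perm_eq _ _](perm_sort geq) perm_sym
       -[perm_eq _ _](perm_sort geq) -/(insert_part k t') -e perm_refl.
move=> s; rewrite mem_filter mem_partitions; apply/andP/mapP => [[ks ps] | [t]].
  have /and3P[ss s0 /eqP sums] := ps.
  have prem : is_part (n - k) (rem k s).
    apply/and3P; split.
    - exact: (subseq_sorted geq_trans (rem_subseq k s)).
    - by apply: contra s0; apply: mem_rem.
    by rewrite -sums (perm_sumn (perm_to_rem ks)) /= addKn.
  exists (rem k s); first by rewrite mem_partitions.
  apply: (is_part_perm_inj ps (is_part_insert k0 prem)).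
  by rewrite perm_sym perm_sort perm_sym perm_to_rem.
rewrite mem_partitions => pt ->; split; first by rewrite mem_sort inE eqxx.
by rewrite -[n](subnKC le_kn); apply: is_part_insert.
Qed.

Lemma sumn_count_mem n s : (forall k, k \in s -> (0 < k <= n)%N) ->
  sumn s = (\sum_(1 <= k < n.+1) k * count_mem k s)%N.
Proof.
elim: s => [|x s IHs] bs /=; first by rewrite big1 // => k _; rewrite muln0.
have bx : x \in index_iota 1 n.+1.
  by rewrite mem_index_iota ltnS; apply: bs; rewrite inE eqxx.
rewrite IHs => [|k ks]; last by apply: bs; rewrite inE ks orbT.
under [RHS]eq_bigr do rewrite mulnDr; rewrite big_split; congr (_ + _)%N.
rewrite (bigD1_seq x) ?iota_uniq //= eqxx muln1 big1 ?addn0 // => k ne_kx.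
by rewrite eq_sym (negPf ne_kx) muln0.
Qed.

Section ExponentialFormula.
Variables (R : comNzRingType) (f : {rmorphism rat -> R}) (c : nat -> R).

Definition part_weight (n : nat) (s : seq nat) : R :=
  \prod_(1 <= k < n.+1) (f ((count_mem k s)`!%:R^-1) * c k ^+ count_mem k s).

(* The coefficient of degree [n] of [exp (\sum_k c k)], where [c k] has degree
   [k]; [f] supplies the rational coefficients. *)
Definition exp_coef (n : nat) : R :=
  \sum_(la : intpart n) part_weight n (parts la).

Lemma part_weight_widen m n s : (forall k, k \in s -> (k <= m)%N) -> (m <= n)%N ->
  part_weight n s = part_weight m s.
Proof.
move=> bs le_mn; rewrite /part_weight (@big_cat_nat _ _ _ m.+1) //=.
rewrite [X in _ * X]big1_seq ?mulr1 //= => k; rewrite mem_index_iota => /andP[lt_mk _].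
rewrite (_ : count_mem k s = 0%N) ?invr1 ?rmorph1 ?mulr1 //.
apply/count_memPn; apply/negP => /bs; lia.
Qed.

(** From [(m+1)/(m+1)! = 1/m!]: marking one of the parts equal to [k] amounts to removing it. *)
Lemma part_weight_insert n k t : (0 < k <= n)%N ->
  (count_mem k (insert_part k t))%:R * part_weight n (insert_part k t) =
  c k * part_weight n t.
Proof.
move=> bk; have ik : k \in index_iota 1 n.+1 by rewrite mem_index_iota ltnS.
rewrite /part_weight (bigD1_seq k) ?iota_uniq //= [in RHS](bigD1_seq k) ?iota_uniq //=.
rewrite [X in _ * (_ * X)](eq_bigr (fun j => f ((count_mem j t)`!%:R^-1) * c j ^+ count_mem j t));
  last by move=> j /negPf ne; rewrite count_insert_part ne.
rewrite !count_insert_part eqxx add1n; set m := count_mem k t.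
have -> : f (m`!%:R^-1) = m.+1%:R * f (m.+1`!%:R^-1).
  by rewrite -(rmorph_nat f) -rmorphM factS natrM invfM mulVKf ?pnatr_eq0.
by rewrite exprS; ring.
Qed.

(** Coefficient form of [x E' = (x C') E] for [E = exp C]. Writing [n] as the sum of all [k] times
    their multiplicity marks a part, and deleting it leaves a partition of [n - k]. *)
Lemma exp_coef_rec n :
  n%:R * exp_coef n = \sum_(1 <= k < n.+1) k%:R * c k * exp_coef (n - k).
Proof.
rewrite /exp_coef -big_partitions big_distrr /=.
rewrite (eq_big_seq (fun s => \sum_(1 <= k < n.+1)
           k%:R * ((count_mem k s)%:R * part_weight n s))); last first.
  move=> s; rewrite mem_partitions => ps; have /and3P[_ _ /eqP sums] := ps.
  rewrite -{1}sums (sumn_count_mem (n := n)) => [|k]; last exact: part_bounds.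
  by rewrite natr_sum big_distrl; apply: eq_bigr => k _ /=; rewrite natrM mulrA.
rewrite exchange_big; apply: eq_big_seq => k; rewrite mem_index_iota ltnS => bk /=.
rewrite -big_distrr -mulrA /=; congr (_ * _).
rewrite (bigID (fun s => k \in s)) /= [X in _ + X]big1 ?addr0 => [|s nks]; last first.
  by rewrite (count_memPn nks) mul0r.
rewrite -big_filter (perm_big _ (partitions_containing bk)) big_map.
rewrite -big_partitions big_distrr; apply: eq_big_seq => t; rewrite mem_partitions => pt /=.
rewrite part_weight_insert // (part_weight_widen (m := n - k)) ?leq_subr // => j /(part_bounds pt).
by case/andP.
Qed.

Lemma exp_coef0 : exp_coef 0 = 1.
Proof.
rewrite /exp_coef -big_partitions (_ : partitions 0 = [:: [::]]).
  by rewrite big_seq1 /part_weight big_geq.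
apply: perm_small_eq => //; apply: uniq_perm => // [|s]; first exact: uniq_partitions.
rewrite mem_partitions inE; apply/idP/eqP => [ps | -> //].
case: s ps => // k s ps; have := part_bounds ps (mem_head _ _); lia.
Qed.

End ExponentialFormula.

(** * Bernoulli numbers and the secant series *)

(** Divisibility by [X^K] stands for equality of power series below degree [K]. *)
Lemma dvdXnP (K : nat) (p : {poly rat}) :
  reflect (forall k, (k < K)%N -> p`_k = 0) ('X^K %| p).
Proof.
apply: (iffP idP) => [/dvdpP[q ->] k lt_k | p0]; first by rewrite coefMXn lt_k.
rewrite -(poly_take_drop K p) (_ : take_poly K p = 0) ?add0r ?dvdp_mulIr //.
by apply/polyP => k; rewrite coef_take_poly coef0; case: ifP => // /p0.
Qed.

Lemma dvdXn_cancel (K : nat) (u p : {poly rat}) :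
  u`_0 != 0 -> 'X^K %| u * p -> 'X^K %| p.
Proof.
move=> u0; rewrite Gauss_dvdpr //; apply: coprimep_expl.
by rewrite coprimep_sym coprimepX /root horner_coef0.
Qed.

(** [x d/dx] keeps the order of vanishing, where [d/dx] alone would lose one; hence its use in the
    differential equations below. *)
Lemma dvdXn_deriv (K : nat) (p : {poly rat}) : 'X^K %| p -> 'X^K %| 'X * p^`().
Proof.
move=> /dvdXnP p0; apply/dvdXnP => -[|k] lt_k; rewrite coefXM //= coef_deriv.
by rewrite p0 ?mul0rn.
Qed.

Section TruncatedSeries.
Variable K : nat.

Definition series_poly (u : nat -> rat) : {poly rat} := \poly_(k < K) u k.

Lemma coef_series_mul u v k : (k < K)%N ->
  (series_poly u * series_poly v)`_k = \sum_(i < k.+1) u i * v (k - i)%N.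
Proof.
move=> lt_k; rewrite coefM; apply: eq_bigr => i _; rewrite !coef_poly.
have le_i := ltn_ord i; rewrite ltnS in le_i.
by rewrite (leq_ltn_trans le_i lt_k) (leq_ltn_trans (leq_subr _ _) lt_k).
Qed.

Definition exp_poly (c : rat) : {poly rat} := series_poly (fun k => c ^+ k / k`!%:R).

Lemma exp_polyD c d : 'X^K %| exp_poly c * exp_poly d - exp_poly (c + d).
Proof.
apply/dvdXnP => k lt_k; rewrite coefB coef_series_mul // coef_poly lt_k.
apply/eqP; rewrite subr_eq0; apply/eqP; rewrite addrC exprDn big_distrl.
apply: eq_bigr => i _ /=; have le_i := ltn_ord i; rewrite ltnS in le_i.
rewrite -mulr_natr -(bin_fact le_i) !natrM.
have nzf j : j`!%:R != 0 :> rat by rewrite pnatr_eq0 -lt0n fact_gt0.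
have nzb : 'C(k, i)%:R != 0 :> rat by rewrite pnatr_eq0 -lt0n bin_gt0.
by field; rewrite nzb !nzf.
Qed.

End TruncatedSeries.

(** * From Bernoulli numbers to the tangent *)

Lemma size_bernoulli_seq n : size (bernoulli_seq n) = n.+1.
Proof. by elim: n => //= n IHn; rewrite size_rcons IHn. Qed.

Lemma nth_bernoulli_seq n k : (k <= n)%N -> (bernoulli_seq n)`_k = bernoulli k.
Proof.
elim: n => [|n IHn]; first by rewrite leqn0 => /eqP ->.
rewrite leq_eqVlt => /orP[/eqP -> // | lt_k] /=.
by rewrite nth_rcons size_bernoulli_seq lt_k IHn.
Qed.

Lemma bernoulli_rec n :
  \sum_(k < n.+1) 'C(n.+1, k)%:R * bernoulli k = (n == 0%N)%:R.
Proof.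
case: n => [|n]; first by rewrite big_ord1 bin0 mul1r.
rewrite big_ord_recr /= {2}/bernoulli /= nth_rcons size_bernoulli_seq ltnn eqxx.
rewrite -bin_sub // subSnn bin1 mulNr mulrN mulVKf ?pnatr_eq0 //.
apply/eqP; rewrite subr_eq0; apply/eqP; apply: eq_bigr => i _.
by rewrite nth_bernoulli_seq // -ltnS.
Qed.

(** Truncation of [B(cz) (e^(cz) - 1) = cz] for [B z = z / (e^z - 1)]; the subtracted 1 removes the
    top term of the convolution and leaves [bernoulli_rec]. *)
Lemma bernoulli_exp_poly K c :
  'X^K %| series_poly K (fun k => c ^+ k * bernoulli k / k`!%:R)
            * (exp_poly K c - 1) - c *: 'X.
Proof.
apply/dvdXnP => k lt_k; rewrite mulrBr mulr1 !coefB coef_series_mul // coefZ coefX.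
rewrite coef_poly lt_k big_ord_recr /= subnn expr0 invr1 !mulr1 addrK.
case: k lt_k => [|k] lt_k; first by rewrite big_ord0 mulr0 subrr.
rewrite eqSS (eq_bigr (fun i : 'I_k.+1 =>
  (c ^+ k.+1 / k.+1`!%:R) * ('C(k.+1, i)%:R * bernoulli i))); last first.
  move=> i _; have le_i : (i <= k.+1)%N by apply/ltnW/ltn_ord.
  rewrite -[in c ^+ k.+1](subnKC le_i) exprD -(bin_fact le_i) !natrM.
  have nzf j : j`!%:R != 0 :> rat by rewrite pnatr_eq0 -lt0n fact_gt0.
  have nzb : 'C(k.+1, i)%:R != 0 :> rat by rewrite pnatr_eq0 -lt0n bin_gt0.
  by field; rewrite nzb !nzf.
rewrite -big_distrr bernoulli_rec /=; case: eqP => [-> | _]; last by rewrite !mulr0 subrr.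
by rewrite expr1 divr1 mulr1 subrr.
Qed.

(* [z tanh z = 2 \sum_k tanh_coef k z^(2k)]. *)
Definition tanh_coef (k : nat) : rat :=
  4 ^+ k * (4 ^+ k - 1) * bernoulli (2 * k) / (2 * (2 * k)`!%:R).

Lemma sum_even_terms (V : nmodType) (g : nat -> V) k :
  (forall j, g (2 * j).+1 = 0) ->
  \sum_(i < (2 * k).+1) g i = \sum_(j < k.+1) g (2 * j)%N.
Proof.
move=> g0; elim: k => [|k IHk]; first by rewrite !big_ord1.
by rewrite mulnS !addSn add0n 2!big_ord_recr /= IHk g0 addr0 [RHS]big_ord_recr /= mulnS.
Qed.

(* With [B z = z / (e^z - 1)] and [F z = B (4z) - B (2z) + z], this is the
   truncation of [F z (e^(2z) + 1) = z (e^(2z) - 1)], i.e. [F z = z tanh z]. *)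
Lemma tanh_exp_poly K :
  'X^K %| (series_poly K.+1 (fun k => 4 ^+ k * bernoulli k / k`!%:R)
           - series_poly K.+1 (fun k => 2 ^+ k * bernoulli k / k`!%:R) + 'X)
          * (exp_poly K.+1 2 + 1) - 'X * (exp_poly K.+1 2 - 1).
Proof.
set B4 := series_poly _ _; set B2 := series_poly _ _; set u := exp_poly _ _.
set w := (_ - _).
case: K @B4 @B2 @u @w => [|K] B4 B2 u w; first by rewrite expr0 dvd1p.
(* [v] truncates [(e^(2z) - 1) / z], a unit with constant term 2; dividing by [z] costs one degree,
   hence [K.+1] in the statement. *)
pose v := \poly_(k < K.+1) (2 ^+ k.+1 / k.+1`!%:R) : {poly rat}.
have uE : u - 1 = 'X * v.
  apply/polyP => k; rewrite coefB coefXM coef1 !coef_poly.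
  case: k => [|k] /=; first by rewrite expr0 invr1 mulr1 subrr.
  by rewrite subr0 ltnS.
have v0 : v`_0 != 0 by rewrite coef_poly mulf_neq0.
apply: (dvdXn_cancel v0); rewrite -(dvdp_mul2l _ _ (negbT (polyX_eq0 rat))) mulrA -uE -exprS.
(* A combination of [B(4z) (e^(4z) - 1) = 4z], [e^(2z) e^(2z) = e^(4z)] and
   [B(2z) (e^(2z) - 1) = 2z]. *)
have -> : (u - 1) * w = (B4 * (exp_poly K.+2 4 - 1) - 4 *: 'X)
    + B4 * (u * u - exp_poly K.+2 4) - (u + 1) * (B2 * (u - 1) - 2 *: 'X).
  by rewrite /w -!mul_polyC !polyC_natr; ring.
have e4 : 2 + 2 = 4 :> rat by ring.
apply: dvdp_sub; last by apply/dvdp_mull/bernoulli_exp_poly.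
apply: dvdp_add; first exact: bernoulli_exp_poly.
by apply: dvdp_mull; rewrite -e4; apply: exp_polyD.
Qed.

(** Half the coefficient of [z^(2k)] in [(z tanh z) cosh z = z sinh z]. *)
Lemma tanh_coef_conv k :
  \sum_(j < k.+1) tanh_coef (k - j) / (2 * j)`!%:R =
  if k is k'.+1 then (2 * (2 * k').+1`!%:R)^-1 else 0.
Proof.
pose K := (2 * k).+2; pose F := series_poly K (fun k => 4 ^+ k * bernoulli k / k`!%:R)
           - series_poly K (fun k => 2 ^+ k * bernoulli k / k`!%:R) + 'X.
have dvdF : 'X^(K.-1) %| F * (exp_poly K 1 + exp_poly K (-1))
                  - 'X * (exp_poly K 1 - exp_poly K (-1)).
  have -> : F * (exp_poly K 1 + exp_poly K (-1)) - 'X * (exp_poly K 1 - exp_poly K (-1))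
    = exp_poly K (-1) * (F * (exp_poly K 2 + 1) - 'X * (exp_poly K 2 - 1))
      - (F - 'X) * (exp_poly K (-1) * exp_poly K 2 - exp_poly K 1) by ring.
  rewrite dvdp_sub // dvdp_mull //; first exact: tanh_exp_poly.
  apply: dvdp_trans (_ : 'X^K %| _); first by rewrite dvdp_exp2l.
  by rewrite (_ : 1 = -1 + 2 :> rat) ?exp_polyD; ring.
have /dvdXnP/(_ (2 * k)%N (ltnSn _)) := dvdF.
rewrite coefB => /eqP; rewrite subr_eq0 => /eqP; rewrite mulrC coefM.
have coefE i : (i < K)%N -> (exp_poly K 1 + exp_poly K (-1))`_i =
    (1 + (-1) ^+ i) / i`!%:R.
  by move=> lt_i; rewrite coefD !coef_poly lt_i expr1n mulrDl.
have lt_K i : (i <= 2 * k)%N -> (i < K)%N by move=> ?; rewrite ltnS leqW.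
rewrite (eq_bigr (fun i : 'I_(2 * k).+1 => (1 + (-1) ^+ i) / i`!%:R * F`_(2 * k - i)));
  last by move=> i _; rewrite coefE // lt_K // -ltnS.
rewrite (@sum_even_terms _ (fun i => (1 + (-1) ^+ i) / i`!%:R * F`_(2 * k - i)));
  last by move=> j; rewrite exprS mulnC exprM sqrr_sign mulr1 subrr !mul0r.
(* One factor 2 comes from [e^z + e^(-z)], the other from [F_(2m) = 2 tanh_coef m]. *)
rewrite (eq_bigr (fun j : 'I_k.+1 => 4 * (tanh_coef (k - j) / (2 * j)`!%:R))); last first.
  move=> j _; rewrite exprM sqrrN !expr1n -mulnBr /tanh_coef; set m := (k - j)%N.
  have lt_m : (2 * m < K)%N by rewrite lt_K // leq_mul2l leq_subr.
  rewrite coefD coefB !coef_poly lt_m coefX (_ : (2 * m == 1)%N = false); last by lia.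
  have nzf i : i`!%:R != 0 :> rat by rewrite pnatr_eq0 -lt0n fact_gt0.
  have -> : 4 ^+ (2 * m) = 4 ^+ m * 4 ^+ m :> rat by rewrite mulnC exprM expr2.
  have -> : 2 ^+ (2 * m) = 4 ^+ m :> rat by rewrite exprM; congr (_ ^+ m); ring.
  by rewrite mulr0n; field; rewrite !nzf.
rewrite -big_distrr /= coefXM => /(canRL (mulKf _)) -> //.
case ek: k => [|k']; first by rewrite muln0 mulr0.
have lt_k' : ((2 * k').+1 < K)%N by rewrite /K ek; lia.
rewrite mulnS /= add1n coefB !coef_poly lt_k' expr1n exprS exprM sqrrN !expr1n mulr1.
have nzf : (2 * k').+1`!%:R != 0 :> rat by rewrite pnatr_eq0 -lt0n fact_gt0.
by field.
Qed.

(* The coefficients of [(sqrt x / 2) tan (sqrt x)], of [cos (sqrt x)] and of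
   [(sqrt x / 2) sin (sqrt x)]. *)
Definition tan_coef (k : nat) : rat := (-1) ^+ k.+1 * tanh_coef k.

Definition cos_coef (k : nat) : rat := (-1) ^+ k / (2 * k)`!%:R.

Definition half_sin_coef (k : nat) : rat :=
  if k is k'.+1 then (-1) ^+ k' / (2 * (2 * k').+1`!%:R) else 0.

Lemma cos_coef_rec k : k%:R * cos_coef k = - half_sin_coef k.
Proof.
case: k => [|k]; rewrite ?mul0r ?oppr0 // /cos_coef /half_sin_coef mulnS add2n factS natrM.
have nzf : (2 * k).+1`!%:R != 0 :> rat by rewrite pnatr_eq0 -lt0n fact_gt0.
rewrite exprS -[(2 * k).+2]/(2 + 2 * k)%N -mulnS natrM; field.
by rewrite nzf nat1r pnatr_eq0.
Qed.

(** For [S = (sqrt x / 2) sin (sqrt x)]: [4 x S' - 2 S = x cos (sqrt x)]. *)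
Lemma half_sin_coef_rec k :
  (4 * k%:R - 2) * half_sin_coef k = if k is k'.+1 then cos_coef k' else 0.
Proof.
case: k => [|k]; rewrite ?mulr0 // /cos_coef /half_sin_coef factS natrM.
have nzf : (2 * k)`!%:R != 0 :> rat by rewrite pnatr_eq0 -lt0n fact_gt0.
rewrite -!natr1 !natrM; field.
by rewrite nzf -natrM natr1 pnatr_eq0.
Qed.

(** The hyperbolic relation at [z^2 = -x]. *)
Lemma tan_coef_conv k :
  \sum_(j < k.+1) tan_coef (k - j) * cos_coef j = half_sin_coef k.
Proof.
rewrite (eq_bigr (fun j : 'I_k.+1 =>
  (-1) ^+ k.+1 * (tanh_coef (k - j) / (2 * j)`!%:R))) => [|j _].
  rewrite -big_distrr /= tanh_coef_conv; case: k => [|k]; first by rewrite mulr0.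
  by rewrite /half_sin_coef !exprS !mulN1r opprK.
rewrite /tan_coef /cos_coef mulrACA -exprD addSn subnK ?mulrA // -ltnS //.
Qed.

Lemma tan_coef0 : tan_coef 0 = 0.
Proof. by rewrite /tan_coef /tanh_coef expr0 subrr !(mulr0, mul0r). Qed.

Lemma tan_poly_cos K :
  'X^K %| series_poly K tan_coef * series_poly K cos_coef - series_poly K half_sin_coef.
Proof.
apply/dvdXnP => k lt_k; rewrite mulrC coefB coef_series_mul // coef_poly lt_k.
by under eq_bigr do rewrite mulrC; rewrite tan_coef_conv subrr.
Qed.

Lemma coef_theta (p : {poly rat}) k : ('X * p^`())`_k = k%:R * p`_k.
Proof. by case: k => [|k]; rewrite coefXM ?mul0r //= coef_deriv mulr_natl. Qed.

Lemma theta_cos_poly K :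
  'X * (series_poly K cos_coef)^`() = - series_poly K half_sin_coef.
Proof.
apply/polyP => k; rewrite coef_theta coefN !coef_poly; case: ifP => _.
  exact: cos_coef_rec.
by rewrite mulr0 oppr0.
Qed.

Lemma theta_half_sin_poly K :
  'X^K %| 4 * ('X * (series_poly K half_sin_coef)^`())
          - 2 * series_poly K half_sin_coef - 'X * series_poly K cos_coef.
Proof.
apply/dvdXnP => k lt_k; rewrite !coefB !mulr_natl !coefMn coef_theta coefXM !coef_poly lt_k.
have := half_sin_coef_rec k; case: k lt_k => [|k] lt_k /=; first by rewrite !mulr0 !mul0rn subrr.
by rewrite (ltnW lt_k) => <-; ring.
Qed.

(* [T = (sqrt x / 2) tan (sqrt x)] satisfies [4 x T' = 2 T + x + 4 T^2], which
   makes its coefficients nonnegative and so removes the absolute values of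
   [phi]. *)
Lemma tan_ode K :
  'X^K %| 4 * ('X * (series_poly K tan_coef)^`()) - 2 * series_poly K tan_coef
          - 'X - 4 * (series_poly K tan_coef * series_poly K tan_coef).
Proof.
case: K => [|K]; first by rewrite expr0 dvd1p.
set T := series_poly _ _; set C := series_poly K.+1 cos_coef.
set S := series_poly K.+1 half_sin_coef.
have C0 : C`_0 != 0 by rewrite coef_poly.
have TC : 'X^(K.+1) %| T * C - S by apply: tan_poly_cos.
have thC : 'X * C^`() = - S by apply: theta_cos_poly.
apply: (dvdXn_cancel C0).
(* Times [C], the equation reduces to the congruence [T C = S] and to the equation of [S], by
   [x C' = -S]. *)
have -> : C * (4 * ('X * T^`()) - 2 * T - 'X - 4 * (T * T)) =
   4 * ('X * (T * C - S)^`()) - (2 + 4 * T) * (T * C - S)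
   + (4 * ('X * S^`()) - 2 * S - 'X * C).
  have -> : 4 * ('X * (T * C - S)^`()) =
            4 * (C * ('X * T^`())) + 4 * T * ('X * C^`()) - 4 * ('X * S^`()).
    by rewrite derivB derivM; ring.
  by rewrite thC; ring.
apply: dvdp_add; last exact: theta_half_sin_poly.
apply: dvdp_sub; last exact: dvdp_mull.
exact/dvdp_mull/dvdXn_deriv.
Qed.

Lemma tan_coef_rec k :
  (4 * k%:R - 2) * tan_coef k =
  (k == 1%N)%:R + 4 * \sum_(i < k.+1) tan_coef i * tan_coef (k - i).
Proof.
have /dvdXnP/(_ k (ltnSn k)) e := tan_ode k.+1.
rewrite !coefB !mulr_natl !coefMn coef_theta coefX coef_series_mul // in e.
rewrite coef_poly ltnSn in e; apply: subr0_eq; rewrite -[RHS]e; ring.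
Qed.

(** For [k > 0] the factor [4k - 2] is positive, and the extreme terms of the convolution vanish
    with [tan_coef 0], so only smaller indices remain. *)
Lemma tan_coef_ge0 k : 0 <= tan_coef k.
Proof.
elim/ltn_ind: k => k IHk; case: (posnP k) => [-> | k0]; first by rewrite tan_coef0.
have k1 : 1 <= k%:R :> rat by rewrite ler1n.
rewrite -(@pmulr_rge0 _ (4 * k%:R - 2)); last by lra.
rewrite tan_coef_rec addr_ge0 ?ler0n // mulr_ge0 // sumr_ge0 // => i _.
case: (posnP i) => [-> | i0]; first by rewrite tan_coef0 mul0r.
have := ltn_ord i; rewrite ltnS leq_eqVlt => /orP[/eqP -> | lt_i].
  by rewrite subnn tan_coef0 mulr0.
by rewrite mulr_ge0 // IHk //; lia.
Qed.

(** * The secant series as an exponential *)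

Definition log_sec_coef (k : nat) : rat :=
  `|(4 ^+ k * (4 ^+ k - 1) * bernoulli (2 * k)) / ((2 * k)%:R * (2 * k)`!%:R)|.

(** [x d/dx log sec (sqrt x) = (sqrt x / 2) tan (sqrt x)]. [tanh_coef] and [tan_coef] agree up to
    sign, so nonnegativity of the latter removes the absolute value. *)
Lemma log_sec_coefE k : (0 < k)%N -> k%:R * log_sec_coef k = tan_coef k.
Proof.
move=> k0; have nzk : k%:R != 0 :> rat by rewrite pnatr_eq0 -lt0n.
have nzf : (2 * k)`!%:R != 0 :> rat by rewrite pnatr_eq0 -lt0n fact_gt0.
rewrite -(ger0_norm (tan_coef_ge0 k)) /tan_coef normrMsign /log_sec_coef.
rewrite -{1}(ger0_norm (ler0n rat k)) -normrM; congr `|_|.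
by rewrite /tanh_coef natrM; field; rewrite nzf.
Qed.

Definition sec_coef : nat -> rat := exp_coef idfun log_sec_coef.

Lemma sec_coef_rec k :
  k%:R * sec_coef k = \sum_(i < k.+1) tan_coef i * sec_coef (k - i).
Proof.
rewrite /sec_coef exp_coef_rec big_ord_recl tan_coef0 mul0r add0r big_add1 big_mkord.
by apply: eq_bigr => i _; rewrite log_sec_coefE.
Qed.

(** As series, [x H' = T H] and [x C' = -S = -T C], so [H C] has zero derivative and equals its
    constant term 1. This is what identifies [sec_coef] with the secant. *)
Lemma sec_cos_conv k :
  \sum_(i < k.+1) sec_coef (k - i) * cos_coef i = (k == 0%N)%:R.
Proof.
pose H := series_poly k.+1 sec_coef; pose C := series_poly k.+1 cos_coef.
pose T := series_poly k.+1 tan_coef; pose S := series_poly k.+1 half_sin_coef.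
have -> : \sum_(i < k.+1) sec_coef (k - i) * cos_coef i = (C * H)`_k.
  by rewrite coef_series_mul //; apply: eq_bigr => i _; rewrite mulrC.
case: (posnP k) => [k0 | k0].
  rewrite coef_series_mul // k0 big_ord1 /sec_coef exp_coef0.
  by rewrite mulr1.
rewrite mulr0n; apply: (mulfI (x := k%:R)); first by rewrite pnatr_eq0 -lt0n.
rewrite mulr0 -coef_theta derivM.
have thH : 'X^(k.+1) %| 'X * H^`() - T * H.
  apply/dvdXnP => i lt_i; rewrite coefB coef_theta coef_series_mul // coef_poly lt_i.
  by rewrite sec_coef_rec subrr.
have -> : 'X * (C^`() * H + C * H^`()) = C * ('X * H^`() - T * H) + H * (T * C - S).
  have -> : S = - ('X * C^`()) by rewrite theta_cos_poly opprK.
  by ring.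
have /dvdXnP : 'X^(k.+1) %| C * ('X * H^`() - T * H) + H * (T * C - S).
  by apply: dvdp_add; apply: dvdp_mull => //; apply: tan_poly_cos.
exact.
Qed.

(** * Symmetric functions *)

Lemma mdeg_seq N (m : 'X_{1..N}) : mdeg m = sumn m.
Proof. by rewrite sumnE. Qed.

Lemma mcoeff_mulX (R : nzRingType) N (p : {mpoly R[N]}) (m k : 'X_{1..N}) :
  (p * 'X_[m])@_k = if (m <= k)%MM then p@_(k - m) else 0.
Proof.
case: ifP => [le_mk | nle_mk]; first by rewrite -{1}(submK le_mk) addmC mcoeffMX.
apply/eqP; rewrite mcoeff_eq0 (perm_mem (msuppMX _ _)); apply/mapP => -[i _ ek].
by rewrite ek lem_addr in nle_mk.
Qed.

Lemma mcoeff_sum_bmnm N d (P : pred 'X_{1..N}) (k : 'X_{1..N}) :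
  (\sum_(m : 'X_{1..N < d} | P m) 'X_[m] : {mpoly rat[N]})@_k =
  ((mdeg k < d)%N && P k)%:R.
Proof.
rewrite raddf_sum /=; under eq_bigr do rewrite mcoeffX.
case: (ltnP (mdeg k) d) => [lt_k | le_k] /=; last first.
  apply: big1 => m _; case: eqP => // e; have := bmdeg m; rewrite e; lia.
case: (boolP (P k)) => Pk.
  rewrite (bigD1 (BMultinom lt_k)) //= eqxx big1 ?addr0 // => m /andP[_ /eqP ne_m].
  by case: eqP => // e; case: ne_m; apply: val_inj.
by apply: big1 => m Pm; case: eqP => // e; rewrite -e Pm in Pk.
Qed.

Definition nonzero_entries N (m : 'X_{1..N}) : seq nat := [seq e <- m | e != 0%N].

Lemma sumn_nonzero_entries N (m : 'X_{1..N}) : sumn (nonzero_entries m) = mdeg m.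
Proof.
rewrite mdeg_seq /nonzero_entries; elim: (tval m) => //= e t IHt.
by case: eqP => [-> | _] /=; rewrite IHt.
Qed.

Lemma mcoeff_monomial_sf s N (m : 'X_{1..N}) :
  (monomial_sf s N)@_m = (perm_eq (nonzero_entries m) s)%:R.
Proof.
rewrite [LHS](@mcoeff_sum_bmnm _ _ (fun m => perm_eq (nonzero_entries m) s)).
case: (boolP (perm_eq _ _)); rewrite ?andbF // andbT.
by move=> /perm_sumn <-; rewrite sumn_nonzero_entries ltnSn.
Qed.

Lemma mcoeff_complete_sf k N (m : 'X_{1..N}) :
  (complete_sf k N)@_m = (mdeg m == k)%:R.
Proof.
rewrite [LHS](@mcoeff_sum_bmnm _ _ (fun m => mdeg m == k)).
by case: eqP => [-> | _]; rewrite ?ltnSn ?andbF.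
Qed.

Definition mvars (N : nat) : seq {mpoly rat[N]} := [seq 'X_i | i : 'I_N].

Lemma coef_prod_mesym N j :
  (\prod_(x <- mvars N) (1 + x *: 'X))`_j = mesym N rat j.
Proof.
rewrite big_image /=; under eq_bigr do rewrite addrC; rewrite bigA_distr coef_sum mesymE.
rewrite [RHS]big_mkcond; apply: eq_bigr => A _ /=.
rewrite -big_mkcond scaler_prod prodr_const coefZ coefXn eq_sym.
case: eqP => _; rewrite ?mulr0 // mulr1 mpolyXE_id [RHS](bigID (mem A)) /=.
rewrite [X in _ = _ * X]big1 ?mulr1 => [|i /negPf nA]; last by rewrite mnmE nA.
by apply: eq_bigr => i iA; rewrite mnmE iA.
Qed.

(** Inclusion-exclusion: the sum factors over the variables as the product of [1 - [m i != 0]]. *)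
Lemma signed_subsets_eq0 N (m : 'X_{1..N}) :
  \sum_(A : {set 'I_N} | (mesym1 A <= m)%MM) (-1) ^+ #|A| = (m == 0%MM)%:R :> rat.
Proof.
transitivity (\prod_(i < N) (- (m i != 0%N)%:R + 1) : rat).
  rewrite bigA_distr big_mkcond; apply: eq_bigr => A _ /=.
  rewrite -prodr_const -big_mkcond; case: mnm_lepP => [le_A | nle_A] /=.
    apply: eq_bigr => i iA; have := le_A i; rewrite mnmE iA.
    by rewrite lt0n => ->.
  apply/esym/eqP/prodf_eq0; have [i /andP[iA mi]] : exists i, (i \in A) && (m i == 0%N).
    apply/existsP; apply: contraT => /existsPn h; case: nle_A => i; rewrite mnmE.
    by have := h i; rewrite negb_and; case: (i \in A) => //=; rewrite -lt0n.
  by exists i; rewrite // mi oppr0.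
case: eqP => [-> | /eqP m0].
  by rewrite big1 // => i _; rewrite mnm0E oppr0 add0r.
have [i mi] : exists i, m i != 0%N.
  apply/existsP; apply: contraR m0 => /existsPn h; apply/eqP/mnmP => i.
  by rewrite mnm0E; apply/eqP; have := h i; rewrite negbK.
by apply/eqP/prodf_eq0; exists i; rewrite // mi addNr.
Qed.

(** [E(-t) H(t) = 1]: in degree [k], the coefficient at [m] is a signed sum over the squarefree
    divisors of [X^m]. *)
Lemma mesym_complete_conv N k :
  \sum_(i < k.+1) (-1) ^+ i * mesym N rat i * complete_sf (k - i) N = (k == 0%N)%:R.
Proof.
apply/mpolyP => m; rewrite raddf_sum /=.
transitivity (\sum_(i < k.+1) \sum_(A : {set 'I_N} | #|A| == i)
    if (mesym1 A <= m)%MM && (mdeg m == k) then (-1) ^+ #|A| else 0 : rat).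
  apply: eq_bigr => i _; have le_i := ltn_ord i; rewrite ltnS in le_i.
  rewrite -mulrA -signr_odd mulr_sign (fun_if (mcoeff m)) mcoeffN -mulr_sign signr_odd.
  rewrite mesymE big_distrl raddf_sum big_distrr; apply: eq_bigr => A /eqP cA /=.
  rewrite ['X_[_] * _]mulrC mcoeff_mulX mcoeff_complete_sf -cA; case: mnm_lepP => [/mnm_lepP le_A | _] /=;
    last by rewrite mulr0.
  have {2}<- := submK le_A; rewrite mdegD mdeg_mesym1 -(eqn_add2r #|A|) subnK ?cA //.
  by case: eqP; rewrite ?mulr1 ?mulr0.
rewrite (exchange_big_dep xpredT) //=.
transitivity (\sum_(A : {set 'I_N} | (mesym1 A <= m)%MM)
    if mdeg m == k then (-1) ^+ #|A| else 0 : rat).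
  rewrite [RHS]big_mkcond; apply: eq_bigr => A _.
  case: (ltnP #|A| k.+1) => [lt_A | le_A].
    rewrite (big_pred1 (Ordinal lt_A)) => [|i]; last by rewrite /= eq_sym.
    by case: mnm_lepP.
  rewrite big_pred0 => [|i]; last by rewrite gtn_eqF // (leq_trans (ltn_ord i)).
  case: ifP => // le_Am; case: eqP => // em.
  have := mdegD (m - mesym1 A)%MM (mesym1 A); rewrite submK // em mdeg_mesym1; lia.
rewrite -mpolyC_nat mcoeffC; case: eqP => [<- | em]; last first.
  rewrite big1 //; case: (eqVneq m 0%MM) em => [-> | _ _]; rewrite ?mulr0 // mdeg0.
  by case: eqP => // ->.
by rewrite signed_subsets_eq0 mdeg_eq0; case: eqP; rewrite ?mulr0 ?mulr1.
Qed.

Definition in_complete_span (n : nat) (f : symfun) : Prop :=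
  exists b : {ffun intpart n -> rat},
    forall N, f N = \sum_(la : intpart n) b la *: complete_part_sf (parts la) N.

Lemma complete_span_ext n f g :
  (forall N, f N = g N) -> in_complete_span n f -> in_complete_span n g.
Proof. by move=> fg [b fb]; exists b => N; rewrite -fg. Qed.

Lemma complete_span0 n : in_complete_span n (fun=> 0).
Proof. by exists [ffun=> 0] => N; rewrite big1 // => la _; rewrite ffunE scale0r. Qed.

Lemma complete_spanD n f g : in_complete_span n f -> in_complete_span n g ->
  in_complete_span n (fun N => f N + g N).
Proof.
move=> [b fb] [c gc]; exists [ffun la => b la + c la] => N.
by rewrite fb gc -big_split; apply: eq_bigr => la _; rewrite ffunE scalerDl.
Qed.

Lemma complete_spanZ n c f : in_complete_span n f ->
  in_complete_span n (fun N => c *: f N).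
Proof.
move=> [b fb]; exists [ffun la => c * b la] => N.
by rewrite fb scaler_sumr; apply: eq_bigr => la _; rewrite ffunE scalerA.
Qed.

Lemma complete_span_sum n (I : Type) (r : seq I) (F : I -> symfun) :
  (forall i, in_complete_span n (F i)) ->
  in_complete_span n (fun N => \sum_(i <- r) F i N).
Proof.
move=> sF; elim: r => [|i r IHr].
  by apply: complete_span_ext (complete_span0 n) => N; rewrite big_nil.
by apply: complete_span_ext (complete_spanD (sF i) IHr) => N; rewrite big_cons.
Qed.

Lemma complete_sf0 N : complete_sf 0 N = 1.
Proof. by apply/mpolyP => m; rewrite mcoeff_complete_sf mcoeff1 mdeg_eq0. Qed.

Lemma complete_span_part s : in_complete_span (sumn s) (complete_part_sf s).
Proof.
pose t := sort geq [seq k <- s | k != 0%N].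
have sum_t : sumn t = sumn s.
  rewrite (perm_sumn (permEl (perm_sort _ _))); elim: (s) => //= k r IHr.
  by case: eqP => [-> | _] /=; rewrite IHr.
have /intpartP[la la_t] : is_part (sumn s) t.
  apply/and3P; split; last exact/eqP; first exact: sort_sorted geq_total _.
  by rewrite mem_sort mem_filter.
exists [ffun mu => (mu == la)%:R] => N.
rewrite (bigD1 la) //= ffunE eqxx scale1r big1 ?addr0 => [|mu /negPf ne]; last first.
  by rewrite ffunE ne scale0r.
rewrite la_t /complete_part_sf (perm_big _ (permEl (perm_sort _ _))) big_filter.
by rewrite [RHS]big_mkcond; apply: eq_bigr => k _; case: eqP => //= ->; rewrite complete_sf0.
Qed.

Lemma complete_span_complete k : in_complete_span k (complete_sf k).
Proof.
have := complete_span_part [:: k]; rewrite /= addn0.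
by apply: complete_span_ext => N; rewrite /complete_part_sf big_seq1.
Qed.

Lemma complete_spanM m n f g : in_complete_span m f -> in_complete_span n g ->
  in_complete_span (m + n) (fun N => f N * g N).
Proof.
move=> [b fb] [c gc].
apply: (@complete_span_ext _ (fun N => \sum_(la : intpart m) \sum_(nu : intpart n)
    (b la * c nu) *: complete_part_sf (parts la ++ parts nu) N)) => [N|].
  rewrite fb gc big_distrl; apply: eq_bigr => la _; rewrite big_distrr.
  by apply: eq_bigr => nu _; rewrite /complete_part_sf big_cat /= -scalerAl -scalerAr scalerA.
apply: complete_span_sum => la; apply: complete_span_sum => nu; apply: complete_spanZ.
have /and3P[_ _ /eqP sum_la] := partsP la; have /and3P[_ _ /eqP sum_nu] := partsP nu.
by have := complete_span_part (parts la ++ parts nu); rewrite sumn_cat sum_la sum_nu.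
Qed.

Lemma complete_span_prod (I : finType) (d : I -> nat) (F : I -> symfun) :
  (forall i, in_complete_span (d i) (F i)) ->
  in_complete_span (\sum_i d i) (fun N => \prod_i F i N).
Proof.
move=> sF; elim: (index_enum I) => [|i r IHr].
  rewrite big_nil; apply: complete_span_ext (complete_span_complete 0) => N.
  by rewrite big_nil complete_sf0.
rewrite big_cons; apply: complete_span_ext (complete_spanM (sF i) IHr) => N.
by rewrite big_cons.
Qed.

(** Solving [E(-t) H(t) = 1] for its last term expresses [e_k] through smaller ones. *)
Lemma complete_span_mesym k : in_complete_span k (fun N => mesym N rat k).
Proof.
elim/ltn_ind: k => k IHk; case: (posnP k) => [-> | k0].
  by apply: complete_span_ext (complete_span_complete 0) => N; rewrite complete_sf0 mesym0E.
apply: (@complete_span_ext _ (fun N => \sum_(i : 'I_k) - ((-1) ^+ (k + i)) *: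
    (mesym N rat i * complete_sf (k - i) N))) => [N|].
  have := mesym_complete_conv N k; rewrite (gtn_eqF k0) big_ord_recr /= subnn complete_sf0.
  rewrite mulr1 addrC => /eqP; rewrite addr_eq0 => /eqP e.
  rewrite -[RHS](signrMK k) e mulrN big_distrr -sumrN; apply: eq_bigr => i _ /=.
  by rewrite scaleNr -mul_mpolyC rmorphXn rmorphN rmorph1 !mulrA -exprD.
apply: complete_span_sum => i; apply: complete_spanZ.
rewrite -[k in in_complete_span k](subnKC (ltnW (ltn_ord i))).
by apply: complete_spanM (IHk _ (ltn_ord i)) (complete_span_complete _).
Qed.

(** Each permutation term either has a factor of negative degree, hence 0, or is a product of
    elementary polynomials of total degree [n]. *)
Lemma complete_span_det l (a b : {ffun 'I_l -> nat}) n :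
  (\sum_i a i = \sum_i b i + n)%N ->
  in_complete_span n (fun N =>
    \det (kernel_mx (shifted_esym (mvars N)) a b)).
Proof.
move=> sum_ab; apply: (@complete_span_ext _ (fun N => \sum_(s : 'S_l) (-1) ^+ s *:
    (\prod_j shifted_esym (mvars N) (a (s j)) (b j)))) => [N|].
  apply: eq_bigr => s _; rewrite -mul_mpolyC rmorphXn rmorphN rmorph1.
  by congr (_ * _); apply: eq_bigr => j _; rewrite mxE.
apply: complete_span_sum => s; apply: complete_spanZ.
have [/forallP le_ba | /forallPn[j lt_ab]] := boolP [forall j, b j <= a (s j)]%N; last first.
  apply: complete_span_ext (complete_span0 n) => N.
  by rewrite (bigD1 j) //= shifted_esymE (negPf lt_ab) mul0r.
have -> : n = (\sum_j (a (s j) - b j))%N.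
  apply/(@addnI (\sum_i b i)%N); rewrite -sum_ab -big_split /= (reindex_inj (@perm_inj _ s)).
  by apply: eq_bigr => j _; rewrite subnKC.
apply: complete_span_prod => j; apply: complete_span_ext (complete_span_mesym _) => N.
by rewrite shifted_esymE le_ba coef_prod_mesym.
Qed.

(** Both sides obey one recursion in [n]: [exp_coef_rec] on the left; on the right, [n] is split as
    [\sum_i m i] and [sec_coef_rec] applies in each variable. *)
Lemma mcoeff_exp_power N n (m : 'X_{1..N}) :
  (exp_coef (mpolyC N (R := rat)) (fun k => log_sec_coef k *: power_sf k N) n)@_m =
  if mdeg m == n then \prod_i sec_coef (m i) else 0.
Proof.
elim/ltn_ind: n m => n IHn m; set Q := exp_coef _ _ in IHn *.
have sec0 : sec_coef 0 = 1 by apply: exp_coef0.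
case: (posnP n) => [-> | n0].
  rewrite /Q exp_coef0 mcoeff1 mdeg_eq0; case: eqP => // ->.
  by rewrite big1 // => i _; rewrite mnm0E.
apply: (mulfI (x := n%:R)); first by rewrite pnatr_eq0 -lt0n.
have -> : n%:R * (Q n)@_m = (n%:R * Q n)@_m by rewrite !mulr_natl mcoeffMn.
rewrite exp_coef_rec -/Q raddf_sum /=.
have shift (i : 'I_N) k : (k <= m i)%N ->
    (mdeg (m - U_(i) *+ k)%MM + k = mdeg m)%N /\
    \prod_j sec_coef ((m - U_(i) *+ k)%MM j) =
      sec_coef (m i - k) * \prod_(j | j != i) sec_coef (m j).
  move=> le_k; have le_U : (U_(i) *+ k <= m)%MM.
    by apply/mnm_lepP => j; rewrite mulmnE mnm1E; case: eqP => [<- | _]; rewrite ?mul1n.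
  split; first by have := mdegD (m - U_(i) *+ k)%MM (U_(i) *+ k)%MM;
    rewrite submK // mdegMn mdeg1 mul1n.
  rewrite (bigD1 i) //= mnmBE mulmnE mnm1E eqxx mul1n; congr (_ * _).
  by apply: eq_bigr => j ne; rewrite mnmBE mulmnE mnm1E eq_sym (negPf ne) subn0.
have term k : (0 < k <= n)%N ->
    (k%:R * (log_sec_coef k *: power_sf k N) * Q (n - k)%N)@_m =
    \sum_i if (k <= m i)%N && (mdeg m == n) then
      tan_coef k * sec_coef (m i - k) * \prod_(j | j != i) sec_coef (m j) else 0.
  move=> /andP[k0 le_k].
  rewrite -scalerAr -scalerAl -mulrA mulr_natl -scaler_nat scalerA.
  rewrite [log_sec_coef k * _]mulrC log_sec_coefE // mcoeffZ.
  rewrite big_distrl raddf_sum big_distrr; apply: eq_bigr => i _ /=.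
  rewrite mpolyXn ['X_[_] * _]mulrC mcoeff_mulX.
  have -> : (U_(i) *+ k <= m)%MM = (k <= m i)%N.
    apply/mnm_lepP/idP => [/(_ i) | le_ki j]; rewrite mulmnE mnm1E ?eqxx ?mul1n //.
    by case: eqP => [<- | _]; rewrite ?mul1n.
  case: (leqP k (m i)) => [le_ki | _] /=; last by rewrite mulr0.
  have [em sh] := shift i k le_ki; rewrite IHn ?sh; last by lia.
  by rewrite -em -{2}(subnK le_k) eqn_add2r; case: eqP; rewrite ?mulr0 ?mulrA.
rewrite (eq_big_seq (fun k => \sum_i if (k <= m i)%N && (mdeg m == n) then
      tan_coef k * sec_coef (m i - k) * \prod_(j | j != i) sec_coef (m j) else 0));
  last by move=> k; rewrite mem_index_iota ltnS => /term.
rewrite exchange_big /=; case: eqP => [em | _]; last first.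
  by rewrite mulr0 big1 // => i _; rewrite big1 // => k _; rewrite andbF.
rewrite -{2}em mdegE natr_sum big_distrl; apply: eq_bigr => i _ /=.
rewrite [in RHS](bigD1 i) //= mulrA sec_coef_rec big_distrl big_ord_recl /= tan_coef0 !mul0r add0r /=.
have le_mi : (m i <= n)%N by rewrite -em mdegE (bigD1 i) //= leq_addr.
rewrite big_add1 /= (@big_cat_nat _ _ _ (m i)) //= [X in _ + X]big1_seq ?addr0 => [|k].
  by rewrite big_mkord; apply: eq_bigr => k _; rewrite andbT ltn_ord.
by case/andP=> _; rewrite mem_index_iota => /andP[le_k _]; rewrite ltnNge le_k.
Qed.

Definition padded_part n (la : intpart n) : 'X_{1..n} :=
  [multinom nth 0%N (parts la) i | i < n].

Lemma nonzero_entries_padded n (la : intpart n) :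
  nonzero_entries (padded_part la) = parts la.
Proof.
have /and3P[_ n0 _] := partsP la; have le_sz : (size (parts la) <= n)%N.
  by rewrite size_map size_bseq.
have -> : nonzero_entries (padded_part la) =
    [seq e <- mkseq (nth 0%N (parts la)) n | e != 0%N].
  by rewrite /nonzero_entries /= /mkseq -val_enum_ord -map_comp.
move: (parts la) n0 le_sz => s n0 le_sz.
have -> : mkseq (nth 0%N s) n = s ++ nseq (n - size s) 0%N.
  apply: (@eq_from_nth _ 0%N) => [|i].
    by rewrite size_mkseq size_cat size_nseq subnKC.
  rewrite size_mkseq => lt_i; rewrite nth_mkseq // nth_cat nth_nseq if_same.
  by case: ltnP => // /(nth_default 0%N).
rewrite filter_cat (eq_in_filter (a2 := predT)) ?filter_predT => [|e e_s /=]; last first.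
  by apply: contraNneq n0 => <-.
by rewrite (eq_in_filter (a2 := pred0)) ?filter_pred0 ?cats0 // => e /nseqP[->].
Qed.

Lemma perm_parts n (la nu : intpart n) : perm_eq (parts la) (parts nu) = (nu == la).
Proof.
apply/idP/eqP => [e | -> //]; apply: parts_inj; apply/esym.
exact: is_part_perm_inj (partsP la) (partsP nu) e.
Qed.

Lemma coordsP n B f :
  (exists b : {ffun intpart n -> rat},
     forall N, f N = \sum_(la : intpart n) b la *: B (parts la) N) ->
  forall N, f N = \sum_(la : intpart n) coords n B f la *: B (parts la) N.
Proof. exact: epsilon_spec. Qed.

(** Read in [n] variables, the coefficient at [padded_part la] isolates the coordinate of [la],
    which gives uniqueness. *)
Lemma coords_monomial n f (c : {ffun intpart n -> rat}) :
  (forall N, f N = \sum_(la : intpart n) c la *: monomial_sf (parts la) N) ->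
  coords n monomial_sf f = c.
Proof.
have coef b la : (forall N, f N = \sum_(la : intpart n) b la *: monomial_sf (parts la) N) ->
    b la = (f n)@_(padded_part la).
  move=> ->; rewrite raddf_sum (bigD1 la) //= mcoeffZ mcoeff_monomial_sf.
  rewrite nonzero_entries_padded perm_parts eqxx mulr1 big1 ?addr0 // => nu ne_nu.
  by rewrite mcoeffZ mcoeff_monomial_sf nonzero_entries_padded perm_parts (negPf ne_nu) mulr0.
move=> fc; apply/ffunP => la; rewrite [RHS](coef c) //; apply: coef.
by apply: coordsP; exists c.
Qed.

Lemma prod_count_mem (R : comNzRingType) (g : nat -> R) n s :
  (forall k, k \in s -> (0 < k <= n)%N) ->
  \prod_(k <- s) g k = \prod_(1 <= k < n.+1) g k ^+ count_mem k s.
Proof.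
elim: s => [|x s IHs] bs /=; first by rewrite big_nil big1.
have bx : x \in index_iota 1 n.+1.
  by rewrite mem_index_iota ltnS; apply: bs; rewrite inE eqxx.
rewrite big_cons IHs => [|k ks]; last by apply: bs; rewrite inE ks orbT.
under [RHS]eq_bigr do rewrite exprD; rewrite big_split; congr (_ * _).
rewrite (bigD1_seq x) ?iota_uniq //= eqxx expr1 big1 ?mulr1 // => k ne_kx.
by rewrite eq_sym (negPf ne_kx).
Qed.

Lemma norm_phi n (la : intpart n) :
  `|phi la| = (2 * n)`!%:R * part_weight idfun log_sec_coef n (parts la).
Proof.
rewrite /phi normrM normr_nat normr_prod; congr (_ * _); apply: eq_bigr => k _.
rewrite normrM normrX normfV normr_nat; reflexivity.
Qed.

Lemma part_weight_scale N (c : nat -> rat) (p : nat -> {mpoly rat[N]}) n s :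
  (forall k, k \in s -> (0 < k <= n)%N) ->
  part_weight (mpolyC N (R := rat)) (fun k => c k *: p k) n s =
  part_weight idfun c n s *: \prod_(k <- s) p k.
Proof.
move=> bs; rewrite (prod_count_mem p bs) -mul_mpolyC rmorph_prod -big_split.
apply: eq_bigr => k _ /=; move: (count_mem k s) => r.
by rewrite exprZn -mul_mpolyC mpolyCM mulrA.
Qed.

Lemma A_sf_exp n N :
  (2 * n)`!%:R *: A_sf n N = (2 * n)`!%:R *:
    exp_coef (mpolyC N (R := rat)) (fun k => log_sec_coef k *: power_sf k N) n.
Proof.
have nzf : (2 * n)`!%:R != 0 :> rat by rewrite pnatr_eq0 -lt0n fact_gt0.
rewrite /A_sf; congr (_ *: _); rewrite scaler_sumr; apply: eq_bigr => la _.
rewrite norm_phi scalerA mulKf // part_weight_scale // => k.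
exact: (part_bounds (partsP la)).
Qed.

Lemma A_sf_monomial n N :
  (2 * n)`!%:R *: A_sf n N =
  \sum_(la : intpart n) ((2 * n)`!%:R * \prod_(k <- parts la) sec_coef k) *:
     monomial_sf (parts la) N.
Proof.
rewrite A_sf_exp; apply/mpolyP => m.
rewrite mcoeffZ mcoeff_exp_power raddf_sum /=.
under [RHS]eq_bigr do rewrite mcoeffZ mcoeff_monomial_sf.
case: eqP => [dm | ne_dm]; last first.
  rewrite mulr0 big1 // => la _; case: (boolP (perm_eq _ _)) => [/perm_sumn|]; rewrite ?mulr0 //.
  by have /and3P[_ _ /eqP ->] := partsP la; rewrite sumn_nonzero_entries.
have /intpartP[la la_m] : is_part n (sort geq (nonzero_entries m)).
  apply/and3P; split; first exact: sort_sorted geq_total _.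
    by rewrite mem_sort mem_filter.
  by rewrite (perm_sumn (permEl (perm_sort _ _))) sumn_nonzero_entries dm.
have pm nu : perm_eq (nonzero_entries m) (parts nu) = (nu == la).
  by rewrite -perm_parts la_m perm_sort.
rewrite (bigD1 la) //= pm eqxx mulr1 [X in _ + X]big1 ?addr0 => [|nu /negPf ne]; last first.
  by rewrite pm ne mulr0.
congr (_ * _); rewrite la_m (perm_big _ (permEl (perm_sort _ _))) big_filter.
rewrite (eq_bigr (fun i => sec_coef (tnth m i))) => [|i _]; last by rewrite mnm_tnth.
rewrite -(big_tuple _ _ m xpredT sec_coef) [RHS]big_mkcond; apply: eq_bigr => k _.
by case: eqP => //= ->; apply: exp_coef0.
Qed.

(** * Schur functions and standard tableaux of rho *)

Definition column_length (s : seq nat) (j : nat) : nat := count (fun k => j < k)%N s.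

Lemma sorted_geq_head x s : sorted geq (x :: s) -> forall k, k \in s -> (k <= x)%N.
Proof.
move=> /= ss k ks; have := order_path_min geq_trans ss.
by move=> /allP/(_ k ks).
Qed.

Lemma lt_column_length s j p : sorted geq s ->
  (p < column_length s j)%N = (j < nth 0%N s p)%N.
Proof.
rewrite /column_length; elim: s p => [|x s IHs] p ss /=; first by rewrite nth_nil !ltn0.
have ss' : sorted geq s by apply: path_sorted ss.
case: (ltnP j x) => [lt_jx | le_xj]; first by case: p => [|p] //=; rewrite add1n ltnS IHs.
have -> : count (fun k => j < k)%N s = 0%N.
  apply/eqP; rewrite -leqn0 leqNgt -has_count; apply/hasPn => k ks.
  by rewrite -leqNgt (leq_trans (sorted_geq_head ss ks)).
apply/esym/negbTE; rewrite -leqNgt; case: p => [|p] //=.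
case: (ltnP p (size s)) => [lt_p | le_p]; last by rewrite nth_default.
by rewrite (leq_trans (sorted_geq_head ss (mem_nth _ lt_p))).
Qed.

Lemma bigmax_sorted s : sorted geq s -> \max_(k <- s) k = head 0%N s.
Proof.
case: s => [|x s] ss; first by rewrite big_nil.
apply/eqP; rewrite eqn_leq /= big_cons leq_maxl andbT geq_max leqnn /=.
by apply/bigmax_leqP_seq => k ks _; apply: sorted_geq_head ss k ks.
Qed.

Lemma column_length_dec s (i j : nat) : (i < j)%N -> (column_length s j <= column_length s i)%N.
Proof. by move=> lt_ij; apply: sub_count => k /=; apply: ltn_trans. Qed.

Lemma sum_column_length s : sorted geq s ->
  (\sum_(i < head 0 s) column_length s i = sumn s)%N.
Proof.
move=> ss; have bs k : k \in s -> (k <= head 0%N s)%N.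
  by case: s ss => // x s ss; rewrite inE => /predU1P[-> // | /(sorted_geq_head ss)].
move: (head 0%N s) bs => l bs {ss}; elim: s bs => [|x s IHs] bs.
  by rewrite big1.
rewrite /column_length /= big_split /= IHs => [|k ks]; last by apply: bs; rewrite inE ks orbT.
congr (_ + _)%N; have le_x : (x <= l)%N by apply: bs; rewrite inE eqxx.
rewrite -(big_mkord xpredT (fun i => (i < x : nat)%N)) (@big_cat_nat _ _ _ x) //=.
rewrite [X in (_ + X)%N]big1_seq ?addn0 => [|i]; last first.
  by rewrite mem_index_iota => /= /andP[le_xi _]; rewrite ltnNge le_xi.
rewrite big_nat (eq_bigr (fun=> 1%N)) => [|i]; last by move=> /andP[_ ->].
by rewrite -big_nat sum_nat_const_nat subn0 muln1.
Qed.

Definition conj_vec (s : seq nat) : {ffun 'I_(head 0%N s) -> nat} :=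
  shifted (fun i : 'I_(head 0%N s) => column_length s i).

Definition zero_vec (s : seq nat) : {ffun 'I_(head 0%N s) -> nat} :=
  shifted (fun _ : 'I_(head 0%N s) => 0%N).

Lemma shifted_strictly_decreasing l (f : 'I_l -> nat) :
  (forall i j : 'I_l, (i < j)%N -> (f j <= f i)%N) -> strictly_decreasing (shifted f).
Proof.
move=> df; apply/strictly_decreasingP => i j lt_ij; rewrite !ffunE.
by move: i j lt_ij; apply/shifted_decreasingP.
Qed.

Lemma size_mvars N : size (mvars N) = N.
Proof. by rewrite size_map size_enum_ord. Qed.

Lemma nth_mvars N (k : 'I_N) : (mvars N)`_k = 'X_k.
Proof. by rewrite (nth_map k) ?size_enum_ord // nth_ord_enum. Qed.

(** Lines are columns: a value occurs at most once in each, so step [k] has weight [x_k] to the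
    number of columns that contain [k]. *)
Lemma schur_sf_det s N : sorted geq s ->
  schur_sf s N = \det (kernel_mx (shifted_esym (mvars N)) (conj_vec s) (zero_vec s)).
Proof.
move=> ss; have e_l := bigmax_sorted ss.
pose line (c : cell (s, [::])) := cast_ord e_l (cell_pos c).2.
have range c : (0 <= crow c < column_length s (line c))%N.
  by rewrite lt_column_length //; have /andP[] := valP c.
have ex (i : 'I_(head 0%N s)) p : (0 <= p < column_length s i)%N ->
    exists2 c, line c = i & crow c = p.
  rewrite lt_column_length // => lt_i; have lt_p : (p < size s)%N.
    by rewrite ltnNge; apply/negP => /(nth_default 0%N) e; rewrite e in lt_i.
  have cP : (nth 0 [::] (Ordinal lt_p, cast_ord (esym e_l) i).1
      <= (Ordinal lt_p, cast_ord (esym e_l) i).2 < nth 0 s (Ordinal lt_p))%N.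
    by rewrite /= nth_nil.
  exists (@Cell (s, [::]) (Ordinal lt_p, cast_ord (esym e_l) i) cP) => //.
  exact: val_inj.
have inj c d : line c = line d -> crow c = crow d -> c = d.
  case: c d => [[c1 c2] cP] [[d1 d2] dP] /= /cast_ord_inj /= e2 /val_inj /= e1.
  by apply: val_inj; rewrite /= e1 e2.
have cdec (i j : 'I_(head 0%N s)) : (i < j)%N -> (column_length s j <= column_length s i)%N.
  exact: column_length_dec.
have ssyt_strict T : is_ssyt T = line_strict line (@crow (s, [::])) (T : {ffun _ -> 'I_N}).
  apply: eq_forallb => c; apply: eq_forallb => d; rewrite andbC.
  by rewrite -(inj_eq val_inj (line c)).
rewrite (det_shifted_esym_chains (size_mvars N)); try exact: shifted_strictly_decreasing.
rewrite -(sum_tableaux_chains range ex inj _ cdec _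
  (fun t => \prod_(k < N) (mvars N)`_k ^+ #|tnth t k|)) //.
apply: eq_big => // T; rewrite ssyt_strict => sT.
rewrite (partition_big T xpredT) //=; apply: eq_bigr => k _.
rewrite nth_mvars (card_fiber inj sT) -prodr_const.
by apply: eq_big => [c | c /eqP ->]; rewrite ?inE.
Qed.

Lemma num_syt_rho_det s : sorted geq s ->
  (num_syt (rho_shape s))%:R = (2 * sumn s)`!%:R *
    \det (kernel_mx (fun p q => inv_fact (2 * p) (2 * q)) (conj_vec s) (zero_vec s)).
Proof.
move=> ss; set l := head 0%N s; set sh := rho_shape s.
have size_sh : size sh.1 = l by rewrite !size_mkseq.
pose mu (i : 'I_l) := (l - i.+1)%N.
pose la (i : 'I_l) := (2 * column_length s i + l - i.+1)%N.
have mu_sh (i : 'I_l) : nth 0%N sh.2 i = mu i.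
  by rewrite /sh /rho_shape /= size_mkseq nth_mkseq.
have la_sh (i : 'I_l) : nth 0%N sh.1 i = la i.
  by rewrite /sh /rho_shape /= size_mkseq nth_mkseq // nth_mkseq.
pose line (c : cell sh) := cast_ord size_sh (cell_pos c).1.
have range c : (mu (line c) <= ccol c < la (line c))%N.
  by rewrite -mu_sh -la_sh; apply: valP c.
have ex (i : 'I_l) p : (mu i <= p < la i)%N -> exists2 c, line c = i & ccol c = p.
  rewrite -mu_sh -la_sh => bp; pose i' := cast_ord (esym size_sh) i.
  have lt_p : (p < \max_(k <- sh.1) k)%N.
    have /andP[_ lt_p] := bp; apply: leq_trans lt_p _.
    by apply: (@leq_bigmax_seq _ sh.1 xpredT id); rewrite // mem_nth // size_sh.
  exists (@Cell sh (i', Ordinal lt_p) bp) => //; exact: val_inj.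
have inj c d : line c = line d -> ccol c = ccol d -> c = d.
  case: c d => [[c1 c2] cP] [[d1 d2] dP] /= /cast_ord_inj /= e1 /val_inj /= e2.
  by apply: val_inj; rewrite /= e1 e2.
have mu_dec (i j : 'I_l) : (i < j)%N -> (mu j <= mu i)%N by rewrite /mu; lia.
have la_dec (i j : 'I_l) : (i < j)%N -> (la j <= la i)%N.
  by move=> lt_ij; have := column_length_dec s lt_ij; rewrite /la; lia.
have mu_la i : (mu i <= la i)%N by rewrite /mu /la; lia.
have la_mu i : (la i - mu i = 2 * column_length s i)%N.
  by have := ltn_ord i; rewrite /mu /la; lia.
have cardC : #|{: cell sh}| = (2 * sumn s)%N.
  rewrite (card_cells range ex inj mu_la) -(sum_column_length ss) big_distrr.
  by apply: eq_bigr => i _; rewrite la_mu.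
(* The staircase in [rho] equals the shift, so both shifted vectors are twice those of the conjugate
   partition. *)
have -> : kernel_mx (fun p q => inv_fact (2 * p) (2 * q)) (conj_vec s) (zero_vec s)
          = kernel_mx inv_fact (shifted la) (shifted mu).
  apply/matrixP => j i; rewrite !mxE !ffunE /mu /la; congr inv_fact.
    by have := ltn_ord i; rewrite -/l; lia.
  by have := ltn_ord j; rewrite -/l; lia.
rewrite -cardC det_inv_fact_chains; try exact: shifted_strictly_decreasing; last first.
  rewrite (card_cells range ex inj mu_la) -big_split; apply: eq_bigr => i _ /=.
  by rewrite !ffunE -{1}(subnKC (mu_la i)) addnAC.
rewrite -(sum_tableaux_chains range ex inj mu_dec la_dec mu_la
  (fun t => \prod_(k < #|{: cell sh}|) (#|tnth t k| == 1%N)%:R)).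
rewrite /num_syt -sum1_card natr_sum (eq_bigl (fun T => is_syt T)) => [|T]; last by rewrite inE.
rewrite big_mkcond [RHS]big_mkcond; apply: eq_bigr => T _.
have [sT | nsT] := boolP (line_strict line (@ccol sh) T); last first.
  rewrite ifF //; apply: contraNF nsT => /andP[_ /'forall_'forall_andP sT].
  apply/'forall_'forall_andP => c d; have [h1 h2] := sT c d; split.
    by rewrite -(inj_eq val_inj (line c)).
  by apply/implyP => /(implyP h2) /ltnW.
(* Among line-strict fillings, standard means injective, that is, every step is a singleton;
   injectivity turns the weak inequalities across rows into strict ones. *)
have -> : is_syt T = [forall k, #|tnth (steps line T) k| == 1%N].
  apply/andP/forallP => [[/injectiveP injT _] k | card1].
    have [|g Tg gT] := inj_card_bij injT; first by rewrite card_ord.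
    rewrite (card_fiber inj sT); apply/cards1P; exists (g k).
    by apply/setP => c; rewrite !inE (can2_eq Tg gT).
  have injT : injective T.
    move=> c d eT; have := card1 (T d); rewrite (card_fiber inj sT) => /cards1P[x ex_x].
    have : c \in [set x] by rewrite -ex_x inE eT.
    have : d \in [set x] by rewrite -ex_x inE.
    by rewrite !inE => /eqP -> /eqP.
  split; first exact/injectiveP.
  have /'forall_'forall_andP sT' := sT; apply/'forall_'forall_andP => c d.
  have [h1 h2] := sT' c d; split; first by rewrite -(inj_eq val_inj (line c)) in h1.
  apply/implyP => h; have := implyP h2 h; rewrite leq_eqVlt => /orP[/eqP/val_inj/injT e|//].
  by move: h; rewrite e ltnn andbF.
case: (boolP [forall k, _]) => [/forallP card1 | /forallPn[k ne1]].
  by rewrite big1 // => k _; rewrite card1.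
by rewrite (bigD1 k) //= (negPf ne1) mul0r.
Qed.

(** * The specialization *)

(** No root is 0, so each factor [X - x] is [-x] times [1 - X/x]; the scalars multiply to the
    constant term 1. *)
Lemma factor_unit_constant (F : closedFieldType) (p : {poly F}) : p`_0 = 1 ->
  exists y : (size p).-1.-tuple F, p = \prod_(i < (size p).-1) (1 + tnth y i *: 'X).
Proof.
move=> p0; have [r rE] := closed_field_poly_normal p.
have nzp : p != 0 by apply: contraTneq (oner_neq0 F) => e; rewrite -p0 e coef0 eqxx.
have size_r : size r == (size p).-1.
  by rewrite rE size_scale ?lead_coef_eq0 // size_prod_XsubC.
have nzr x : x \in r -> x != 0.
  move=> xr; apply: contraTneq (oner_neq0 F) => x0.
  have : root p x by rewrite rE rootZ ?lead_coef_eq0 // root_prod_XsubC.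
  by rewrite /root x0 horner_coef0 p0 => ->.
exists [tuple of [seq - x^-1 | x <- Tuple size_r]].
rewrite (eq_bigr (fun i => 1 + (- (tnth (Tuple size_r) i)^-1) *: 'X)) => [|i _];
  last by rewrite tnth_map.
rewrite -(big_tuple _ _ (Tuple size_r) xpredT (fun x => 1 + (- x^-1) *: 'X)) /=.
have prodE : \prod_(x <- r) ('X - x%:P) =
    (\prod_(x <- r) - x) *: \prod_(x <- r) (1 + (- x^-1) *: 'X).
  rewrite -scaler_prod; apply: eq_big_seq => x /nzr nzx.
  by rewrite scalerDr scalerA mulrNN divff // scale1r addrC -alg_polyC scaleNr.
have q0 : (\prod_(x <- r) (1 + (- x^-1) *: 'X : {poly F}))`_0 = 1.
  rewrite -horner_coef0 horner_prod big1 // => x _.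
  by rewrite !hornerE.
have c1 : lead_coef p * \prod_(x <- r) - x = 1.
  by rewrite -[RHS]p0 [in RHS]rE prodE scalerA coefZ q0 mulr1.
by rewrite {1}rE prodE scalerA c1 scale1r.
Qed.

(** The truncation of [\sum_k t^k / (2k)!] factors into terms [1 + y_i t]; its degree is exactly
    [K], so there is one factor per variable. *)
Lemma esym_specialization K :
  exists y : 'I_K -> algC,
    forall k, (k <= K)%N -> mmap ratr y (mesym K rat k) = ((2 * k)`!%:R)^-1.
Proof.
pose p : {poly algC} := \poly_(k < K.+1) ((2 * k)`!%:R)^-1.
have size_p : size p = K.+1.
  by rewrite size_poly_eq // invr_eq0 pnatr_eq0 -lt0n fact_gt0.
have p0 : p`_0 = 1 by rewrite coef_poly muln0 invr1.
have [y py] := factor_unit_constant p0.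
rewrite size_p /= in y py; exists (tnth y) => k le_k.
have <- : p`_k = ((2 * k)`!%:R)^-1 by rewrite coef_poly ltnS le_k.
suff -> : p = map_poly (mmap ratr (tnth y)) (\prod_(x <- mvars K) (1 + x *: 'X)).
  by rewrite coef_map coef_prod_mesym.
rewrite rmorph_prod [LHS]py [RHS]big_image; apply: eq_bigr => i _ /=.
by rewrite rmorphD rmorph1 /= map_polyZ map_polyX /= mmapX mmap1U.
Qed.

Section Specialization.
Variables (K : nat) (y : 'I_K -> algC).
Hypothesis esym_y :
  forall k, (k <= K)%N -> mmap ratr y (mesym K rat k) = ((2 * k)`!%:R)^-1.

(** [E(-t) H(t) = 1] and [sec * cos = 1] are the same recursion once [(-1)^k e_k] becomes
    [cos_coef k]. *)
Lemma complete_specialization k : (k <= K)%N ->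
  mmap ratr y (complete_sf k K) = ratr (sec_coef k).
Proof.
elim/ltn_ind: k => k IHk le_k.
have e := congr1 (mmap ratr y) (mesym_complete_conv K k).
(* The common value [[k = 0]] is replaced by the secant-cosine sum; the tails agree by induction,
   and the heads are the claim. *)
rewrite rmorph_nat -(rmorph_nat (ratr : {rmorphism rat -> algC})) -sec_cos_conv in e.
rewrite !rmorph_sum !big_ord_recl /= !subn0 /cos_coef mesym0E expr0 muln0 in e.
rewrite !mul1r invr1 mulr1 in e.
suff tail_eq : \sum_(i < k) mmap ratr y ((-1) ^+ bump 0 i * mesym K rat (bump 0 i)
      * complete_sf (k - bump 0 i) K) =
    \sum_(i < k) ratr (sec_coef (k - bump 0 i)
      * ((-1) ^+ bump 0 i / (2 * bump 0 i)`!%:R)).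
  by move: e; rewrite tail_eq => /addIr.
apply: eq_bigr => i _; have lt_i := ltn_ord i; rewrite /bump add1n.
rewrite !rmorphM /= IHk; [|lia|lia].
rewrite esym_y; last lia.
by rewrite fmorphV !rmorph_nat !rmorphXn !rmorphN !rmorph1 mulrC.
Qed.

Lemma shifted_esym_specialization p q : (p <= K)%N ->
  mmap ratr y (shifted_esym (mvars K) p q) = ratr (inv_fact (2 * p) (2 * q)).
Proof.
move=> le_p; rewrite shifted_esymE /inv_fact leq_mul2l /=; case: ifP => _; last by rewrite !rmorph0.
rewrite coef_prod_mesym esym_y ?(leq_trans (leq_subr _ _)) //.
by rewrite -mulnBr fmorphV rmorph_nat.
Qed.

End Specialization.

Theorem theorem6p2 (n : nat) (hn : (1 <= n)%N) (la : intpart n) :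
  hall n (fun N => (2 * n)`!%:R *: A_sf n N) (schur_sf (parts la))
    = (num_syt (rho_shape (parts la)))%:R.
Proof.
have /and3P[ss _ /eqP sum_s] := partsP la; set s := parts la in ss sum_s *.
rewrite (num_syt_rho_det ss) sum_s.
rewrite /hall (coords_monomial (c := [ffun nu : intpart n =>
  (2 * n)`!%:R * \prod_(k <- parts nu) sec_coef k])); last first.
  by move=> N; rewrite A_sf_monomial; apply: eq_bigr => nu _; rewrite ffunE.
set b := coords n complete_part_sf _.
under eq_bigr do rewrite ffunE -mulrA; rewrite -big_distrr /=; congr (_ * _).
have sum_vec : (\sum_i conj_vec s i = \sum_i zero_vec s i + n)%N.
  rewrite -sum_s -(sum_column_length ss) -big_split; apply: eq_bigr => i _ /=.
  by rewrite !ffunE add0n addnC.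
have schur_b N : schur_sf s N = \sum_(nu : intpart n) b nu *: complete_part_sf (parts nu) N.
  apply: coordsP; apply: complete_span_ext (complete_span_det sum_vec) => N'.
  by rewrite schur_sf_det.
(* Large enough for the parts of each [nu], at most [n], and for every entry of [conj_vec], which
   bounds the degrees in the determinant. *)
pose K := (n + \sum_i conj_vec s i)%N.
have [y esym_y] := esym_specialization K.
apply: (fmorph_inj (ratr : {rmorphism rat -> algC})).
transitivity (mmap ratr y (schur_sf s K)).
  rewrite schur_b !rmorph_sum; apply: eq_bigr => nu _ /=.
  rewrite mmapZ rmorphM mulrC; congr (_ * _); rewrite !rmorph_prod.
  apply: eq_big_seq => k /(part_bounds (partsP nu))/andP[_ le_k] /=.
  by rewrite (complete_specialization esym_y) // (leq_trans le_k) // leq_addr.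
rewrite schur_sf_det // -!det_map_mx; congr (\det _).
apply/matrixP => j i; rewrite !mxE /= (shifted_esym_specialization esym_y) //.
by rewrite /K (bigD1 i) //=; lia.
Qed.
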